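(* Let $d\geq 2$ be an integer. Then there exists an effectively computable number $\mathbf{S}_{\mathrm{mo}}(d)\in(1/2,1)$, which tends to $1$ as $d$ tends to infinity, such that, for any $\mathbf{S}_{\mathrm{mo}}(d)<\sigma\leq 1$, any $t\in\mathbb{R}$ (with $s:=\sigma+it$) and almost every $a\in[0,+\infty)$, $$\lim_{N\to\infty}\frac{1}{N}\sum_{n=1}^{N}\left|\zeta\left(s+ian^d\right)\right|^2=\zeta(2\sigma).$$
   Context: $\zeta$ denotes the Riemann zeta-function (meromorphically continued to $\mathbb{C}$) and $s=\sigma+it$ denotes a complex variable with real part $\sigma$ and imaginary part $t$. ''Almost every'' is with respect to Lebesgue measure on $[0,+\infty)$. *)

(* Defs.v *)
(* Mathematical Components + MathComp-Analysis. *)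
From HB Require Import structures.
From mathcomp Require Export all_boot all_order all_algebra.
From mathcomp Require Export all_classical all_reals all_analysis.
From mathcomp Require Export complex.

Set Implicit Arguments.
Unset Strict Implicit.
Unset Printing Implicit Defensive.
Export Order.TTheory GRing.Theory Num.Theory.
Export numFieldNormedType.Exports.

Local Open Scope classical_set_scope.
Local Open Scope ring_scope.

(* The normed-space topology on the complex numbers lives on the regular
   module [R[i]^o]. *)

(* [f] is the sum of a convergent power series on a whole disc around [z0]. *)
Definition analytic_at (R : realType) (f : R[i] -> R[i]) (z0 : R[i]) : Prop :=
  exists c : nat -> R[i],
    \forall z \near (z0 : R[i]^o),
      series (fun k => c k * (z - z0) ^+ k : R[i]^o) @ \oo --> (f z : R[i]^o).

(* Laurent expansion with finite principal part on a punctured disc; the value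
   of [f] at [z0] itself plays no role. *)
Definition meromorphic_at (R : realType) (f : R[i] -> R[i]) (z0 : R[i]) : Prop :=
  exists (m : nat) (c : nat -> R[i]),
    \forall z \near (z0 : R[i]^o)^',
      series (fun k => c k * (z - z0) ^+ k : R[i]^o) @ \oo -->
        ((z - z0) ^+ m * f z : R[i]^o).

Definition cexp (R : realType) (z : R[i]) : R[i] :=
  ((expR (complex.Re z))%:C * (cos (complex.Im z) +i* sin (complex.Im z)))%C.

(* [n ^ (- s)] for [n >= 1]. *)
Definition npow_opp (R : realType) (n : nat) (s : R[i]) : R[i] :=
  cexp (- s * (ln (n%:R : R))%:C%C).

(* [zeta] is the meromorphic continuation to the whole plane of the Dirichlet
   series of the n^(-s), n >= 1. By the identity theorem this determines [zeta]
   everywhere except for its value at the pole 1, which is left arbitrary. *)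
Definition is_riemann_zeta (R : realType) (zeta : R[i] -> R[i]) : Prop :=
  [/\ forall s : R[i], 1 < complex.Re s ->
        series (fun k => npow_opp k.+1 s : R[i]^o) @ \oo --> (zeta s : R[i]^o),
      forall s : R[i], meromorphic_at zeta s
    & forall s : R[i], s != 1 -> analytic_at zeta s].

(* Total general recursive functions of n variables. Minimization is restricted
   to functions having a zero for every value of the parameters, so that only
   total functions are generated. *)
Inductive recursive : forall n : nat, (n.-tuple nat -> nat) -> Prop :=
| rec_zero : recursive (fun _ : 0.-tuple nat => 0%N)
| rec_succ : recursive (fun v : 1.-tuple nat => (thead v).+1)
| rec_proj n (i : 'I_n) : recursive (fun v : n.-tuple nat => tnth v i)
| rec_comp m n (f : m.-tuple nat -> nat) (g : 'I_m -> n.-tuple nat -> nat) :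
    recursive f -> (forall i, recursive (g i)) ->
    recursive (fun v : n.-tuple nat => f [tuple g i v | i < m])
| rec_prim n (f : n.-tuple nat -> nat) (g : n.+2.-tuple nat -> nat)
    (h : n.+1.-tuple nat -> nat) :
    recursive f -> recursive g ->
    (forall v : n.-tuple nat, h [tuple of 0%N :: v] = f v) ->
    (forall (k : nat) (v : n.-tuple nat),
       h [tuple of k.+1 :: v] = g [tuple of k :: h [tuple of k :: v] :: v]) ->
    recursive h
| rec_min n (f : n.+1.-tuple nat -> nat) (h : n.-tuple nat -> nat) :
    recursive f ->
    (forall v : n.-tuple nat, f [tuple of h v :: v] = 0%N) ->
    (forall (v : n.-tuple nat) (k : nat),
       (k < h v)%N -> f [tuple of k :: v] <> 0%N) ->
    recursive h.

(* Computable sequence of real numbers: an algorithm outputs, from [d] and [k],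
   a rational (p - q) / (r + 1) within 2^(-k) of [x d]. *)
Definition computable_seq (R : realType) (x : nat -> R) : Prop :=
  exists p q r : 2.-tuple nat -> nat,
    [/\ recursive p, recursive q, recursive r
      & forall d k : nat,
          `|x d - ((p [tuple d; k])%:R - (q [tuple d; k])%:R)
                    / (r [tuple d; k]).+1%:R| <= 2%:R ^- k].

(* Main.v *)
(* Since [Smo d] only has to tend to 1, take [1 - Smo d = 1 / (22 (d + 1))]: then
   [k ^ (- sigma) <= j / k] for all [k <= X = j ^ (22 d)], so that losses of a
   power of [X ^ (1 - sigma)] are harmless against [N = j ^ 11].

   First-order Euler-Maclaurin gives [zeta s = P s + X ^ (1 - s) / (s - 1) - s * tail],
   with [P] the Dirichlet polynomial of length [X]. It holds for [Re s > 1] and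
   propagates to [Re s > 0] along each horizontal line [Im s = u <> 0], both sides
   being real analytic there: in [v = ln y] the tail is a Laplace transform of a
   bounded function. At [s + i a n ^ d] with [n <= N] the error is negligible in
   mean square.

   For the diagonal, the mean of [|P|^2] contributes [zeta (2 sigma)]. The
   off-diagonal part [G_j (a)] is a sum of [cos ((t + a n ^ d) ln (k / l))]; by a
   weighted Cauchy-Schwarz inequality over the pairs [(k, l)] and
   [|n ^ d - m ^ d| >= |n - m|], its square has integral [O (j ^ -2)] over
   [0 <= a <= M]. Hence [\sum_j G_j (a) ^ 2] is finite and [G_j (a) --> 0] for
   almost every [a]. As the summands [|zeta|^2] are nonnegative, convergence of the
   means along [N = j ^ 11] implies convergence along all [N]. *)
Require Import Defs.
From mathcomp Require Import measurable_realfun ring lra zify.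

Set Implicit Arguments.
Unset Strict Implicit.
Unset Printing Implicit Defensive.
Local Open Scope classical_set_scope.
Local Open Scope ring_scope.

(** * Laplace transforms *)

Lemma is_derive_mulfun (R : realType) (f g : R -> R) (x a b : R) :
  is_derive x 1 f a -> is_derive x 1 g b ->
  is_derive x 1 (fun v : R => f v * g v) (a * g x + f x * b).
Proof.
move=> df dg; apply: (is_derive_eq (is_deriveM df dg)).
by rewrite addrC /GRing.scale /= [g x * a]mulrC.
Qed.

Lemma is_derive_scale (R : realType) (c : R) (f : R -> R) (x a : R) :
  is_derive x 1 f a -> is_derive x 1 (fun v : R => c * f v) (c * a).
Proof. exact: is_deriveZ. Qed.

Lemma is_derive_affine (R : realType) (p c x : R) :
  is_derive x 1 (fun v : R => p + c * v) c.
Proof.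
have := is_deriveD (is_derive_cst p x 1) (is_derive_scale c (is_derive_id x 1)).
by rewrite add0r mulr1.
Qed.

Lemma is_derive_linear (R : realType) (c x : R) :
  is_derive x 1 (fun v : R => c * v) c.
Proof. by have := is_derive_scale c (is_derive_id x 1); rewrite mulr1. Qed.

Lemma is_derive_expRM (R : realType) (c x : R) :
  is_derive x 1 (fun v : R => expR (c * v)) (c * expR (c * x)).
Proof.
rewrite mulrC.
exact: (is_derive1_comp (is_derive_expR (c * x)) (is_derive_linear c x)).
Qed.

Lemma continuous_expRM (R : realType) (c : R) : continuous (fun v : R => expR (c * v)).
Proof.
move=> v; apply: continuous_comp; last exact: continuous_expR.
by apply: continuousM => //; exact: cst_continuous.
Qed.

Lemma Rintegral_FTC (R : realType) (f F : R -> R) (a b : R) : a <= b ->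
  continuous f -> (forall x : R, is_derive x 1 F (f x)) ->
  \int[lebesgue_measure]_(x in `[a, b]) f x = F b - F a.
Proof.
move=> ab cf dF.
have cF : continuous (F : R -> R).
  by move=> x; apply/differentiable_continuous/derivable1_diffP; exact: ex_derive.
move: ab; rewrite le_eqVlt => /orP[/eqP <-|ab].
  by rewrite set_itv1 Rintegral_set1 subrr.
rewrite /Rintegral (@continuous_FTC2 R f F a b) //.
- exact: continuous_subspaceT.
- split; first by move=> x _; exact: ex_derive.
  + exact/cvg_at_right_filter/cF.
  + exact/cvg_at_left_filter/cF.
- by move=> x _; rewrite derive1E; exact: derive_val.
Qed.

Lemma integral_expR_tail (R : realType) (x A : R) : 0 < x ->
  (\int[lebesgue_measure]_(v in `[A, +oo[) (expR (- x * v))%:E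
     = (expR (- x * A) / x)%:E)%E.
Proof.
move=> x0; have xN0 : x != 0 by rewrite gt_eqF.
have dF (v : R) : is_derive v 1 (fun v => - x^-1 * expR (- x * v)) (expR (- x * v)).
  apply: (is_derive_eq (is_derive_scale (- x^-1) (is_derive_expRM (- x) v))).
  by rewrite mulrA mulrNN mulVf // mul1r.
rewrite (@ge0_continuous_FTC2y _ _ (fun v => - x^-1 * expR (- x * v)) A 0) //.
- by rewrite mulNr EFinN add0e oppeK mulrC.
- by apply: continuous_subspaceT; exact: continuous_expRM.
- rewrite -[X in _ --> X](mulr0 (- x^-1)); apply: cvgM; first exact: cvg_cst.
  rewrite (_ : (fun v => expR (- x * v)) =
               (fun z => expR (- z)) \o (fun z => x * z)); last first.
    by apply: eq_fun => v; rewrite mulNr.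
  apply: (@cvg_comp _ _ _ _ _ _ (pinfty_nbhs R)); last exact: cvgr_expR.
  exact: gt0_cvgMry.
- by apply/cvg_at_right_filter; apply: cvgM; [exact: cvg_cst|exact: continuous_expRM].
- by move=> v _; rewrite derive1E; exact: derive_val.
Qed.

Lemma integrable_expR_tail (R : realType) (x A : R) : 0 < x ->
  lebesgue_measure.-integrable `[A, +oo[ (EFin \o (fun v => expR (- x * v))).
Proof.
move=> x0; apply/integrableP; split.
  apply/measurable_EFinP; apply: measurable_funTS.
  by apply: continuous_measurable_fun; exact: continuous_expRM.
under eq_integral do rewrite /= ger0_norm ?expR_ge0 //.
by rewrite integral_expR_tail // ltry.
Qed.

Lemma integrable_scale_expR_tail (R : realType) (M x A : R) : 0 < x ->
  lebesgue_measure.-integrable `[A, +oo[ (EFin \o (fun v => M * expR (- x * v))).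
Proof.
move=> x0; have := integrableZl _ M (integrable_expR_tail A x0).
by apply.
Qed.

Lemma sum_exp_coeff_le (R : realType) (n : nat) (y : R) : 0 <= y ->
  \sum_(0 <= k < n) y ^+ k / k`!%:R <= expR y.
Proof.
move=> y0; rewrite /expR.
apply: (@nondecreasing_cvgn_le _ (series (exp_coeff y))); last exact: is_cvg_series_exp_coeff.
apply: nondecreasing_series => k _ _; exact: exp_coeff_ge0.
Qed.

Lemma exp_coeff_le (R : realType) (n : nat) (y : R) : 0 <= y ->
  y ^+ n / n`!%:R <= expR y.
Proof.
move=> y0; apply: le_trans (sum_exp_coeff_le n.+1 y0).
rewrite big_nat_recr //= lerDr; apply: sumr_ge0 => k _.
by rewrite divr_ge0 ?exprn_ge0.
Qed.

Lemma Rintegral_sum d (T : measurableType d) (R : realType)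
    (mu : {measure set T -> \bar R}) (D : set T) (I : Type) (s : seq I)
    (f : I -> T -> R) : measurable D ->
  (forall i, mu.-integrable D (EFin \o f i)) ->
  \int[mu]_(x in D) (\sum_(i <- s) f i x) = \sum_(i <- s) \int[mu]_(x in D) f i x.
Proof.
move=> mD fi; rewrite /Rintegral.
under eq_integral do rewrite -sumEFin.
rewrite integral_sum // sum_fine // => i _.
exact: (integrable_fin_num mD (fi i)).
Qed.

Lemma laplace_integrable (R : realType) (phi : R -> R) (M x : R) : 0 < x ->
  measurable_fun setT phi -> (forall v, `|phi v| <= M) ->
  lebesgue_measure.-integrable `[0, +oo[ (EFin \o (fun v => phi v * expR (- x * v))).
Proof.
move=> x0 mphi bphi.
have M0 : 0 <= M by apply: le_trans (bphi 0).
apply: (le_integrable _ _ _ (integrable_scale_expR_tail M 0 x0)) => //.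
- apply/measurable_EFinP/measurable_funTS/measurable_funM => //.
  by apply: continuous_measurable_fun; exact: continuous_expRM.
- move=> v _ /=; rewrite lee_fin !normrM (ger0_norm (expR_ge0 _)) (ger0_norm M0).
  by rewrite ler_wpM2r ?expR_ge0.
Qed.

(** Expand [expR (- h * v)] in powers of [h] and integrate term by term. The partial sums of that
    series are at most [expR (]|h| * v)[in modulus, so]M * expR (- (x0 - [|h|) * v)] dominates,
    which is integrable as long as [|h| < x0]. *)
Lemma laplace_analytic (R : realType) (phi : R -> R) (M x0 : R) : 0 < x0 ->
  measurable_fun setT phi -> (forall v, `|phi v| <= M) ->
  exists c : nat -> R, forall h, `|h| < x0 ->
    series (fun k => c k * h ^+ k) @ \oo -->
      \int[lebesgue_measure]_(v in `[0, +oo[) (phi v * expR (- (x0 + h) * v)).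
Proof.
move=> x0_gt0 mphi bphi.
have M0 : 0 <= M by apply: le_trans (bphi 0).
pose D : set R := `[0, +oo[%classic.
have mD : measurable D by exact: measurable_itv.
pose mu := @lebesgue_measure R.
have D0 v : D v -> 0 <= v by rewrite /D /= in_itv /= andbT.
pose a k v : R := phi v * expR (- x0 * v) * ((- v) ^+ k / k`!%:R).
have ma k : measurable_fun setT (a k).
  apply: measurable_funM.
    apply: measurable_funM => //.
    by apply: continuous_measurable_fun; exact: continuous_expRM.
  apply: measurable_funM => //.
  by apply: measurable_funX; apply: continuous_measurable_fun; exact: opp_continuous.
have ia : forall k, mu.-integrable D (EFin \o a k).
  move=> k.
  (* Half of the decay absorbs the power of [v], through [(e v) ^ k / k! <= expR (e v)]; the other
     half keeps the bound integrable. *)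
  have [e e0 xE] : exists2 e : R, 0 < e & x0 = e + e.
    by exists (x0 / 2); [rewrite divr_gt0|lra].
  apply: (le_integrable _ _ _ (integrable_scale_expR_tail (M / e ^+ k) 0 e0)) => //.
    by apply/measurable_EFinP; apply: measurable_funTS; exact: ma.
  - move=> v /D0 v0 /=; rewrite lee_fin /a !normrM (ger0_norm M0).
    rewrite !(ger0_norm (expR_ge0 _)) normrX normrN (ger0_norm v0).
    rewrite [`|k`!%:R^-1|]ger0_norm ?invr_ge0 // [`|e ^- k|]ger0_norm ?invr_ge0 ?exprn_ge0 ?(ltW e0) //.
    rewrite -!mulrA; apply: ler_pM => //.
      by rewrite mulr_ge0 ?expR_ge0 // divr_ge0 // exprn_ge0.
    rewrite [leRHS]mulrC ler_pdivlMr ?exprn_gt0 //.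
    have -> : - x0 * v = - e * v + - (e * v) by rewrite xE; ring.
    rewrite expRD -!mulrA ler_piMr ?expR_ge0 // expRN ler_pdivrMl ?expR_gt0 // mulr1.
    apply: le_trans (exp_coeff_le k (mulr_ge0 (ltW e0) v0)).
    rewrite exprMn le_eqVlt; apply/orP; left; apply/eqP; ring.
exists (fun k => \int[mu]_(v in D) a k v) => h hx0.
pose f n v : R := \sum_(0 <= k < n) a k v * h ^+ k.
have fE n v : f n v = phi v * expR (- x0 * v) * series (exp_coeff (- h * v)) n.
  rewrite /f /series /= mulr_sumr; apply: eq_bigr => k _.
  rewrite /a /exp_coeff /= -mulrA; congr (_ * _).
  by rewrite mulrAC -exprMn; congr (_ ^+ _ / _); ring.
have sumE n : series (fun k => \int[mu]_(v in D) a k v * h ^+ k) n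
              = \int[mu]_(v in D) f n v.
  rewrite /f Rintegral_sum // => [|k].
    by apply: eq_bigr => k _; rewrite RintegralZr.
  by have := integrableZr _ (h ^+ k) (ia k); apply; exact: mD.
rewrite [X in X @ _ --> _](_ : _ = fun n => \int[mu]_(v in D) f n v); last exact/funext/sumE.
apply: fine_cvg; rewrite fineK; last first.
  apply: integrable_fin_num => //; apply: laplace_integrable mphi bphi.
  by move: hx0; rewrite ltr_norml; lra.
have xh0 : 0 < x0 - `|h| by lra.
apply: (@dominated_cvg _ _ _ mu D _ (fun n v => (f n v)%:E) _
  (fun v => (M * expR (- (x0 - `|h|) * v))%:E)) => //.
- move=> n; apply/measurable_EFinP; apply: measurable_funTS.
  apply: measurable_sum => k; by apply: measurable_funM => //; exact: ma.
- move=> v /D0 v0; apply: cvg_EFin; first by near=> n.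
  rewrite (_ : - (x0 + h) * v = - x0 * v + - h * v); last ring.
  rewrite expRD mulrA; under eq_fun do rewrite /= fE.
  apply: cvgM; first exact: cvg_cst.
  exact: is_cvg_series_exp_coeff.
- exact: integrable_scale_expR_tail.
- move=> n v /D0 v0; rewrite lee_fin fE !normrM -mulrA; apply: ler_pM => //.
  rewrite (ger0_norm (expR_ge0 _)).
  rewrite (_ : - (x0 - `|h|) * v = - x0 * v + `|h| * v); last ring.
  rewrite expRD ler_wpM2l ?expR_ge0 //.
  apply: le_trans (sum_exp_coeff_le n (mulr_ge0 (normr_ge0 h) v0)).
  apply: le_trans (ler_norm_sum _ _ _) _.
  apply: ler_sum => k _; rewrite /exp_coeff /= normrM normrX normrM normrN.
  by rewrite (ger0_norm v0) ger0_norm ?invr_ge0.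
Unshelve. all: by end_near. Qed.

(** * Identity theorem on a half-line *)

Definition real_analytic_at (R : realType) (f : R -> R) (x0 : R) : Prop :=
  exists c : nat -> R, \forall h \near (0 : R),
    series (fun k => c k * h ^+ k) @ \oo --> f (x0 + h).

Lemma sum_geometric_le (R : realType) (q : R) (m n : nat) : 0 <= q -> q <= 1 / 2 ->
  \sum_(m <= k < n) q ^+ k <= 2 * q ^+ m.
Proof.
move=> q0 q2; have [nm|mn] := leqP n m.
  by rewrite big_geq // mulr_ge0 ?exprn_ge0.
(* The added term makes the induction on [n] work, since [q ^ n + 2 q ^ (n + 1) <= 2 q ^ n]. *)
suff: \sum_(m <= k < n) q ^+ k + 2 * q ^+ n <= 2 * q ^+ m.
  by apply: le_trans; rewrite lerDl mulr_ge0 ?exprn_ge0.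
elim: n mn => // n IH; rewrite ltnS leq_eqVlt => /orP[/eqP <-|mn].
  rewrite big_nat1 exprS; set p := q ^+ m; have p0 : 0 <= p by rewrite exprn_ge0.
  have : 0 <= (1 - 2 * q) * p by rewrite mulr_ge0 //; lra.
  by rewrite mulrBl mul1r -mulrA; lra.
rewrite big_nat_recr ?(ltnW mn) //=; apply: le_trans (IH mn).
rewrite exprS; set p := q ^+ n; have p0 : 0 <= p by rewrite exprn_ge0.
have : 0 <= (1 - 2 * q) * p by rewrite mulr_ge0 //; lra.
by rewrite mulrBl mul1r -mulrA; lra.
Qed.

(** Strong induction on [m]. Convergence at [r = d / 2] bounds [c k * r ^ k] by some [B]; once the
    earlier coefficients vanish, [|c m| h ^ m] is at most a partial sum, which tends to 0, plus a
    tail of order [h ^ (m + 1)]. Only positive [h] enter, as the identity theorem knows the function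
    on one side only. *)
Lemma power_series_coef0 (R : realType) (c : nat -> R) (d : R) : 0 < d ->
  (forall h, 0 < h < d -> series (fun k => c k * h ^+ k) @ \oo --> (0 : R)) ->
  forall m, c m = 0.
Proof.
move=> d0 c0; pose r := d / 2.
have r0 : 0 < r by rewrite divr_gt0.
have cr : cvgn (series (fun k => c k * r ^+ k)).
  by apply/cvg_ex; exists 0; apply: c0; rewrite r0 /r; lra.
have [B [B0 Bc]] : exists B, 0 < B /\ forall k, `|c k * r ^+ k| <= B.
  have := cvg_seq_bounded (cvgP _ (cvg_series_cvg_0 cr)).
  move=> [M [_ HM]]; exists (`|M| + 1); split; first by rewrite ltr_wpDl.
  by move=> k; apply: HM => //; rewrite (le_lt_trans (ler_norm M)) // ltrDl.
apply: ltn_ind => m IH; apply/eqP; rewrite -normr_le0.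
apply/ler_addgt0Pl => e e0; rewrite addr0.
(* The first bound gives [h / r <= 1 / 2]; the second makes the tail [2 B (h / r) ^ (m + 1)] at most
   [e * h ^ m]. *)
pose h := Num.min (r / 2) (e * r ^+ m.+1 / (2 * B)).
have h0 : 0 < h by rewrite lt_min !divr_gt0 ?mulr_gt0 ?exprn_gt0.
have hr : h <= r / 2 by rewrite ge_min lexx.
have he : h <= e * r ^+ m.+1 / (2 * B) by rewrite ge_min lexx orbT.
have hd : 0 < h < d by rewrite h0 /=; move: hr; rewrite /r; lra.
pose q := h / r.
have q0 : 0 <= q by rewrite divr_ge0 ?ltW.
have q2 : q <= 1 / 2 by rewrite ler_pdivrMr //; lra.
have key n : (m < n)%N ->
    `|c m| * h ^+ m <= `|series (fun k => c k * h ^+ k) n| + 2 * B * q ^+ m.+1.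
  move=> mn; rewrite /series /= (@big_cat_nat _ _ _ m.+1) //= big_nat_recr //=.
  rewrite big1_seq ?add0r; last first.
    by move=> k /=; rewrite mem_index_iota => km; rewrite IH ?mul0r.
  set S := \sum_(_ <= _ < _) _.
  have SB : `|S| <= 2 * B * q ^+ m.+1.
    apply: le_trans (ler_norm_sum _ _ _) _.
    rewrite -mulrA mulrCA; apply: le_trans (ler_wpM2l (ltW B0) (sum_geometric_le _ n q0 q2)).
    rewrite mulr_sumr; apply: ler_sum => k _.
    rewrite (_ : c k * h ^+ k = c k * r ^+ k * q ^+ k); last first.
      by rewrite -mulrA -exprMn [r * q]mulrC divfK // gt_eqF.
    by rewrite normrM [X in _ * X]ger0_norm ?exprn_ge0 // ler_wpM2r ?exprn_ge0.
  rewrite -{1}(ger0_norm (exprn_ge0 m (ltW h0))) -normrM.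
  rewrite -lerBlDr; apply: le_trans (lerB_normD _ _).
  by rewrite lerB.
have lim0 : (fun n => `|series (fun k => c k * h ^+ k) n| + 2 * B * q ^+ m.+1) @ \oo
    --> `|0 : R| + 2 * B * q ^+ m.+1.
  by apply: cvgD; [apply: cvg_norm; exact: c0|exact: cvg_cst].
have : `|c m| * h ^+ m <= `|0 : R| + 2 * B * q ^+ m.+1.
  rewrite -(cvg_lim _ lim0) //; apply: limr_ge; first by apply/cvg_ex; eexists; exact: lim0.
  by near=> n; apply: key; near: n; exact: nbhs_infty_gt.
rewrite normr0 add0r /q expr_div_n exprS => H.
rewrite -(ler_pM2r (exprn_gt0 m h0)); apply: le_trans H _.
rewrite mulrA ler_pdivrMr ?exprn_gt0 //.
move: he; rewrite ler_pdivlMr ?mulr_gt0 // => he.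
rewrite mulrA [leRHS]mulrAC ler_wpM2r ?exprn_ge0 ?(ltW h0) //.
by rewrite mulrC.
Unshelve. all: by end_near. Qed.

(** Let [c] be the supremum of the positive points where [f] is nonzero. Since [f] vanishes to the
    right of [c], its Taylor coefficients at [c] are zero, so [f] vanishes also a little to the left
    of [c], against the choice of [c]. *)
Lemma real_analytic_identity (R : realType) (f : R -> R) :
  (forall x, 0 < x -> real_analytic_at f x) -> (forall x, 1 < x -> f x = 0) ->
  forall x, 0 < x -> f x = 0.
Proof.
move=> fan f1 x x0; apply/eqP/negPn/negP => fx.
pose E := [set y : R | 0 < y /\ f y != 0].
have Ex : E x by [].
have ubE : ubound E 1.
  by move=> y [_ fy]; rewrite leNgt; apply: contra fy => y1; rewrite f1.
have hE : has_sup E by split; [exists x|exists 1].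
have cx : x <= sup E by exact: ub_le_sup (proj2 hE) _ Ex.
have c0 : 0 < sup E by exact: lt_le_trans cx.
have fgt y : sup E < y -> f y = 0.
  move=> cy; apply/eqP/negPn/negP => fy.
  have : E y by split => //; exact: lt_trans cy.
  by move/(ub_le_sup (proj2 hE)); rewrite leNgt cy.
have [c /nbhs_ballP[d /= d0 cd]] := fan _ c0.
have cz : forall m, c m = 0.
  apply: (power_series_coef0 d0) => h /andP[h0 hd].
  rewrite -(fgt (sup E + h)); last by rewrite ltrDl.
  by apply: cd; rewrite /ball /= sub0r normrN gtr0_norm.
have [y [y0 fy] yc] := sup_adherent d0 hE.
have yc' : y <= sup E by exact: ub_le_sup (proj2 hE) _ (conj y0 fy).
have := cd (y - sup E).
rewrite /ball /= sub0r normrN distrC ger0_norm ?subr_ge0 // (_ : sup E + (y - sup E) = y); last by ring.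
move=> H.
have /H : sup E - y < d by lra.
rewrite (_ : series _ = fun=> 0); last first.
  by apply/funext => n; rewrite /series /= big1 // => k _; rewrite cz mul0r.
move=> H0; move/negP: fy; apply; apply/eqP.
by rewrite -(cvg_lim _ H0) // lim_cst.
Qed.

(** * Complex power series along horizontal lines *)

Lemma cvg_complexP (R : realType) (u : nat -> R[i]) (z : R[i]) :
  (u : nat -> R[i]^o) @ \oo --> (z : R[i]^o) <->
  (fun n => complex.Re (u n)) @ \oo --> complex.Re z /\
  (fun n => complex.Im (u n)) @ \oo --> complex.Im z.
Proof.
split.
  move=> uz; split; apply/cvgrPdist_lt => e e0.
    move/cvgrPdist_lt : uz => /(_ e%:C%C); rewrite ltcR => /(_ e0).
    apply: filterS => n; rewrite normc_def ltcR; apply: le_lt_trans.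
    rewrite -sqrtr_sqr -raddfB ler_wsqrtr //; last by rewrite lerDl sqr_ge0.
  move/cvgrPdist_lt : uz => /(_ e%:C%C); rewrite ltcR => /(_ e0).
  apply: filterS => n; rewrite normc_def ltcR; apply: le_lt_trans.
  rewrite -sqrtr_sqr -raddfB ler_wsqrtr //; last by rewrite lerDr sqr_ge0.
move=> [/cvgrPdist_lt uRe /cvgrPdist_lt uIm]; apply/cvgrPdist_lt => e.
(* In the partial order of the complex numbers a positive [e] is a positive real. *)
rewrite ltcE /= => /andP[/eqP Im0 Re0].
have -> : e = (complex.Re e)%:C%C by case: e Im0 {Re0} => a b /= ->.
have e2 : 0 < complex.Re e / 2 by rewrite divr_gt0.
near=> n; rewrite normc_def ltcR.
rewrite -[ltRHS](@ger0_norm _ (complex.Re e)) ?(ltW Re0) // -sqrtr_sqr ltr_sqrt ?exprn_gt0 //.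
have h1 : `|complex.Re z - complex.Re (u n)| < complex.Re e / 2 by near: n; exact: uRe.
have h2 : `|complex.Im z - complex.Im (u n)| < complex.Re e / 2 by near: n; exact: uIm.
rewrite !raddfB /= -[X in X + _]real_normK ?num_real // -[X in _ + X]real_normK ?num_real //.
have := normr_ge0 (complex.Re z - complex.Re (u n)).
have := normr_ge0 (complex.Im z - complex.Im (u n)).
move: h1 h2; set a := `|_ - _|; set b := `|_ - _|; set r := complex.Re e => h1 h2 b0 a0.
have A : a * a <= r / 2 * (r / 2) by apply: ler_pM => //; exact: ltW.
have B : b * b <= r / 2 * (r / 2) by apply: ler_pM => //; exact: ltW.
have r2 : 0 < r * r by rewrite mulr_gt0.
by rewrite !expr2; lra.
Unshelve. all: by end_near. Qed.

Lemma cvg_real_complex (R : realType) (u : nat -> R) (x : R) :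
  u @ \oo --> x -> (fun n => (u n)%:C%C : R[i]^o) @ \oo --> (x%:C%C : R[i]^o).
Proof. by move=> ux; apply/cvg_complexP; split => //=; exact: cvg_cst. Qed.

(** Analyticity in the real variable only, with complex coefficients: it is stable under
    multiplication by [s] on the line, and it reduces to real analyticity of the two components. *)
Definition line_analytic (R : realType) (g : R -> R[i]) (x0 : R) : Prop :=
  exists c : nat -> R[i], \forall h \near (0 : R),
    series (fun k => c k * h%:C%C ^+ k : R[i]^o) @ \oo --> (g (x0 + h) : R[i]^o).

Lemma line_analyticD (R : realType) (f g : R -> R[i]) (x0 : R) :
  line_analytic f x0 -> line_analytic g x0 -> line_analytic (fun x => f x + g x) x0.
Proof.
move=> [c fc] [d gd]; exists (fun k => c k + d k).
apply: filterS (filterI fc gd) => h [hf hg].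
rewrite (_ : series _ = series (fun k => c k * h%:C%C ^+ k : R[i]^o)
  + series (fun k => d k * h%:C%C ^+ k : R[i]^o)).
  exact: cvgD hf hg.
apply/funext => n; rewrite /series /=; under eq_bigr do rewrite mulrDl.
exact: big_split.
Qed.

Lemma line_analytic_mul (R : realType) (w : R[i]) (f : R -> R[i]) (x0 : R) :
  line_analytic f x0 -> line_analytic (fun x => (x%:C%C + w) * f x) x0.
Proof.
move=> [c fc].
(* The factor is [(x0 + w) + h], and multiplication by [h] shifts the coefficients by one. *)
pose d k := (x0%:C%C + w) * c k + (if k is j.+1 then c j else 0).
exists d; apply: filterS fc => h ch.
rewrite -(cvg_shiftS (series _)).
rewrite (_ : (fun n => _) = (fun n =>
   (x0%:C%C + w) * series (fun k => c k * h%:C%C ^+ k : R[i]^o) n.+1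
   + h%:C%C * series (fun k => c k * h%:C%C ^+ k : R[i]^o) n)).
  rewrite raddfD /= addrAC mulrDl; apply: cvgD; apply: cvgM.
  - exact: cvg_cst.
  - by rewrite (cvg_shiftS (series _)).
  - exact: cvg_cst.
  - exact: ch.
apply/funext => n; rewrite /series /=.
under eq_bigr do rewrite /d mulrDl.
rewrite big_split /=; congr (_ + _).
  by rewrite mulr_sumr; apply: eq_bigr => k _; rewrite mulrA.
rewrite big_nat_recl //= mul0r add0r mulr_sumr; apply: eq_bigr => k _.
by rewrite exprS mulrCA.
Qed.

Lemma line_analytic_cst (R : realType) (w : R[i]) (x0 : R) : line_analytic (fun=> w) x0.
Proof.
exists (fun k => if k is 0 then w else 0); near=> h.
rewrite -(cvg_shiftS (series _)).
rewrite (_ : (fun n => _) = fun=> w); first exact: cvg_cst.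
apply/funext => n; rewrite /series /= big_nat_recl //= expr0 mulr1.
by rewrite big1 ?addr0 // => k _; rewrite mul0r.
Unshelve. all: by end_near. Qed.

Lemma line_analytic_horizontal (R : realType) (f : R[i] -> R[i]) (x0 u : R) :
  analytic_at f (x0 +i* u)%C -> line_analytic (fun x => f (x +i* u)%C) x0.
Proof.
move=> [c /nbhs_ballP[e /=]].
rewrite ltcE /= => /andP[/eqP Im0 Re0] fc; exists c.
apply/nbhs_ballP; exists (complex.Re e) => //= h.
rewrite /ball /= sub0r normrN => he.
have := fc ((x0 + h) +i* u)%C.
have -> : ((x0 + h) +i* u)%C - (x0 +i* u)%C = h%:C%C.
  by apply/eqP; rewrite eq_complex /= addrAC subrr add0r subrr !eqxx.
apply; rewrite /ball /=.
have -> : (x0 +i* u)%C - ((x0 + h) +i* u)%C = (- h)%:C%C.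
  by apply/eqP; rewrite eq_complex /= opprD addrA subrr add0r subrr !eqxx.
have -> : e = (complex.Re e)%:C%C by case: e Im0 {Re0 fc he} => a b /= ->.
by rewrite normc_def /= expr0n /= addr0 sqrtr_sqr normrN ltcR.
Qed.

Lemma ReM_real (R : realType) (z : R[i]) (x : R) : complex.Re (z * x%:C%C) = complex.Re z * x.
Proof. by case: z => a b /=; rewrite mulr0 subr0. Qed.

Lemma ImM_real (R : realType) (z : R[i]) (x : R) : complex.Im (z * x%:C%C) = complex.Im z * x.
Proof. by case: z => a b /=; rewrite mulr0 add0r. Qed.

Lemma line_analytic_Re (R : realType) (g : R -> R[i]) (x0 : R) :
  line_analytic g x0 <->
  real_analytic_at (fun x => complex.Re (g x)) x0 /\
  real_analytic_at (fun x => complex.Im (g x)) x0.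
Proof.
have RC (h : R) k : h%:C%C ^+ k = (h ^+ k)%:C%C :> R[i] by rewrite rmorphXn.
have reS (c : nat -> R[i]) h n : complex.Re (series (fun k => c k * h%:C%C ^+ k) n)
    = series (fun k => complex.Re (c k) * h ^+ k) n.
  by rewrite /series /= raddf_sum; apply: eq_bigr => k _ /=; rewrite RC ReM_real.
have imS (c : nat -> R[i]) h n : complex.Im (series (fun k => c k * h%:C%C ^+ k) n)
    = series (fun k => complex.Im (c k) * h ^+ k) n.
  by rewrite /series /= raddf_sum; apply: eq_bigr => k _ /=; rewrite RC ImM_real.
split=> [[c gc]|[[a ga] [b gb]]].
  split.
    exists (fun k => complex.Re (c k)); apply: filterS gc => h /cvg_complexP[+ _].
    by rewrite (eq_cvg _ _ (reS c h)).
  exists (fun k => complex.Im (c k)); apply: filterS gc => h /cvg_complexP[_].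
  by rewrite (eq_cvg _ _ (imS c h)).
exists (fun k => (a k +i* b k)%C).
apply: filterS (filterI ga gb) => h [ha hb]; apply/cvg_complexP.
by split; [rewrite (eq_cvg _ _ (reS _ h))|rewrite (eq_cvg _ _ (imS _ h))].
Qed.

Lemma line_analytic_identity (R : realType) (g : R -> R[i]) :
  (forall x, 0 < x -> line_analytic g x) -> (forall x, 1 < x -> g x = 0) ->
  forall x, 0 < x -> g x = 0.
Proof.
move=> ga g1 x x0; apply/eqP; rewrite eq_complex; apply/andP; split; apply/eqP.
  apply: (real_analytic_identity (f := fun x => complex.Re (g x)) _ _ x0) => y y0; last by rewrite g1.
  by have /line_analytic_Re[] := ga _ y0.
apply: (real_analytic_identity (f := fun x => complex.Im (g x)) _ _ x0) => y y0; last by rewrite g1.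
by have /line_analytic_Re[] := ga _ y0.
Qed.

(** * The Euler-Maclaurin formula for zeta *)

Lemma is_derive_cosM (R : realType) (c x : R) :
  is_derive x 1 (fun v : R => cos (c * v)) (- c * sin (c * x)).
Proof.
rewrite mulNr mulrC -mulNr.
exact: (is_derive1_comp (is_derive_cos (c * x)) (is_derive_linear c x)).
Qed.

Lemma is_derive_sinM (R : realType) (c x : R) :
  is_derive x 1 (fun v : R => sin (c * v)) (c * cos (c * x)).
Proof.
rewrite mulrC.
exact: (is_derive1_comp (is_derive_sin (c * x)) (is_derive_linear c x)).
Qed.

Lemma continuous_cosM (R : realType) (c : R) : continuous (fun v : R => cos (c * v)).
Proof.
move=> v; apply: continuous_comp; last exact: continuous_cos.
by apply: continuousM => //; exact: cst_continuous.
Qed.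

Lemma continuous_sinM (R : realType) (c : R) : continuous (fun v : R => sin (c * v)).
Proof.
move=> v; apply: continuous_comp; last exact: continuous_sin.
by apply: continuousM => //; exact: cst_continuous.
Qed.

Lemma cexpD (R : realType) (z w : R[i]) : cexp (z + w) = cexp z * cexp w.
Proof.
case: z w => [a b] [c d]; rewrite /cexp /= expRD cosD sinD.
by apply/eqP; rewrite eq_complex /=; apply/andP; split; apply/eqP; ring.
Qed.

Lemma cexp0 (R : realType) : cexp (0 : R[i]) = 1.
Proof.
rewrite /cexp /= expR0 cos0 sin0.
by apply/eqP; rewrite eq_complex /=; apply/andP; split; apply/eqP; ring.
Qed.

Lemma cexp_real (R : realType) (x : R) : cexp x%:C%C = (expR x)%:C%C.
Proof.
rewrite /cexp /= cos0 sin0.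
by apply/eqP; rewrite eq_complex /=; apply/andP; split; apply/eqP; ring.
Qed.

Lemma cexpNM (R : realType) (x u v : R) :
  cexp (- (x +i* u)%C * v%:C%C)
  = ((expR (- x * v) * cos (u * v)) +i* - (expR (- x * v) * sin (u * v)))%C.
Proof.
rewrite /cexp /= !mulr0 subr0 add0r !mulNr cosN sinN.
by apply/eqP; rewrite eq_complex /=; apply/andP; split; apply/eqP; ring.
Qed.

(** The integral of [exp (- s v)] for [s = x + i u], by components because the integral at hand is
    that of real functions. *)
Definition expcis_integral (R : realType) (x u a b : R) : R[i] :=
  ((\int[lebesgue_measure]_(v in `[a, b]) (expR (- x * v) * cos (u * v)))
   +i* - (\int[lebesgue_measure]_(v in `[a, b]) (expR (- x * v) * sin (u * v))))%C.

Lemma integrable_continuous_itv (R : realType) (f : R -> R) (a b : R) :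
  continuous f -> lebesgue_measure.-integrable `[a, b] (EFin \o f).
Proof.
move=> cf; apply: continuous_compact_integrable; first exact: segment_compact.
exact: continuous_subspaceT.
Qed.

Lemma continuous_expRM_cosM (R : realType) (x u : R) :
  continuous (fun v : R => expR (x * v) * cos (u * v)).
Proof. by move=> v; apply: cvgM; [exact: continuous_expRM|exact: continuous_cosM]. Qed.

Lemma continuous_expRM_sinM (R : realType) (x u : R) :
  continuous (fun v : R => expR (x * v) * sin (u * v)).
Proof. by move=> v; apply: cvgM; [exact: continuous_expRM|exact: continuous_sinM]. Qed.

Lemma Rintegral_lin2 (R : realType) (p q a b : R) (f g : R -> R) :
  continuous f -> continuous g ->
  \int[lebesgue_measure]_(v in `[a, b]) (p * f v + q * g v)
  = p * \int[lebesgue_measure]_(v in `[a, b]) f v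
    + q * \int[lebesgue_measure]_(v in `[a, b]) g v.
Proof.
move=> cf cg.
have cst_cont (c : R) (h : R -> R) : continuous h -> continuous (fun v => c * h v).
  by move=> ch v; apply: cvgM; [exact: cvg_cst|exact: ch].
rewrite RintegralD //; last first.
  - exact: integrable_continuous_itv (cst_cont q g cg).
  - exact: integrable_continuous_itv (cst_cont p f cf).
by rewrite !RintegralZl //; exact: integrable_continuous_itv.
Qed.

(** The fundamental theorem of calculus on each component. Keeping [s] as a factor on the left
    avoids the assumption [s != 0]. *)
Lemma mul_expcis_integral (R : realType) (x u a b : R) : a <= b ->
  (x +i* u)%C * expcis_integral x u a b
  = cexp (- (x +i* u)%C * a%:C%C) - cexp (- (x +i* u)%C * b%:C%C).
Proof.
move=> ab; rewrite !cexpNM /expcis_integral.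
have H1 := Rintegral_lin2 x u a b (@continuous_expRM_cosM _ (- x) u) (@continuous_expRM_sinM _ (- x) u).
have H2 := Rintegral_lin2 (- u) x a b (@continuous_expRM_cosM _ (- x) u) (@continuous_expRM_sinM _ (- x) u).
have cl (p q : R) : continuous (fun v : R => p * (expR (- x * v) * cos (u * v))
    + q * (expR (- x * v) * sin (u * v))).
  move=> v; apply: cvgD; apply: cvgM; try exact: cvg_cst.
    exact: continuous_expRM_cosM.
  exact: continuous_expRM_sinM.
have d1 (v : R) : is_derive v 1 (fun v : R => -1 * (expR (- x * v) * cos (u * v)))
    (x * (expR (- x * v) * cos (u * v)) + u * (expR (- x * v) * sin (u * v))).
  apply: (is_derive_eq (is_derive_scale (-1)
    (is_derive_mulfun (is_derive_expRM (- x) v) (is_derive_cosM u v)))).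
  ring.
have d2 (v : R) : is_derive v 1 (fun v : R => -1 * (expR (- x * v) * sin (u * v)))
    (- u * (expR (- x * v) * cos (u * v)) + x * (expR (- x * v) * sin (u * v))).
  apply: (is_derive_eq (is_derive_scale (-1)
    (is_derive_mulfun (is_derive_expRM (- x) v) (is_derive_sinM u v)))).
  ring.
have E1 := Rintegral_FTC ab (cl x u) d1.
have E2 := Rintegral_FTC ab (cl (- u) x) d2.
rewrite {}H1 in E1; rewrite {}H2 in E2.
by apply/eqP; rewrite eq_complex /=; apply/andP; split; apply/eqP; lra.
Qed.

(** * The tail integral of the fractional part, in the variable [v = ln y] *)

Definition frac_exp (R : realType) (v : R) : R := expR v - (Num.floor (expR v))%:~R.

Lemma frac_exp_bounds (R : realType) (v : R) : 0 <= frac_exp v <= 1.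
Proof.
by rewrite /frac_exp; have /andP[] := floor_itv (expR v); rewrite intrD => h1 h2; lra.
Qed.

Lemma measurable_frac_exp (R : realType) : measurable_fun setT (@frac_exp R).
Proof.
apply: measurable_funB.
  by apply: continuous_measurable_fun; exact: continuous_expR.
apply: nondecreasing_measurable => // x y xy.
by rewrite ler_int le_floor // ler_expR.
Qed.

Lemma frac_expE (R : realType) (n : nat) (v : R) :
  ln n.+1%:R <= v < ln n.+2%:R -> frac_exp v = expR v - n.+1%:R.
Proof.
move=> /andP[nv vn]; rewrite /frac_exp (@floor_def _ _ n.+1%:Z) //.
have -> : (n.+1%:Z + 1)%:~R = n.+2%:R :> R by rewrite -natr1 intrD.
by rewrite -[X in X <= _ < _]lnK ?posrE // -[X in _ <= _ < X]lnK ?posrE // ler_expR ltr_expR nv.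
Qed.

(* In the variable [y = expR v], the integral of [{y} y ^ (- s - 1)] over
   [y >= expR a], where [s = x + i u]. *)
Definition zeta_tail (R : realType) (a x u : R) : R[i] :=
  ((\int[lebesgue_measure]_(v in `[a, +oo[) (frac_exp v * cos (u * v) * expR (- x * v)))
   +i* - (\int[lebesgue_measure]_(v in `[a, +oo[) (frac_exp v * sin (u * v) * expR (- x * v))))%C.

Lemma measurable_frac_exp_cosM (R : realType) (u : R) :
  measurable_fun setT (fun v : R => frac_exp v * cos (u * v)).
Proof.
apply: measurable_funM; first exact: measurable_frac_exp.
by apply: continuous_measurable_fun; exact: continuous_cosM.
Qed.

Lemma measurable_frac_exp_sinM (R : realType) (u : R) :
  measurable_fun setT (fun v : R => frac_exp v * sin (u * v)).
Proof.
apply: measurable_funM; first exact: measurable_frac_exp.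
by apply: continuous_measurable_fun; exact: continuous_sinM.
Qed.

Lemma frac_exp_mul_le1 (R : realType) (v w : R) : -1 <= w <= 1 -> `|frac_exp v * w| <= 1.
Proof.
move=> w1; rewrite normrM -(mulr1 1); apply: ler_pM => //; last by rewrite ler_norml.
by have /andP[f0 f1] := frac_exp_bounds v; rewrite ger0_norm.
Qed.

Lemma frac_exp_cosM_le1 (R : realType) (u v : R) : `|frac_exp v * cos (u * v)| <= 1.
Proof. by apply: frac_exp_mul_le1; rewrite cos_geN1 cos_le1. Qed.

Lemma frac_exp_sinM_le1 (R : realType) (u v : R) : `|frac_exp v * sin (u * v)| <= 1.
Proof. by apply: frac_exp_mul_le1; rewrite sin_geN1 sin_le1. Qed.

Lemma laplace_tail_bound (R : realType) (phi : R -> R) (a x : R) : 0 <= a -> 0 < x ->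
  measurable_fun setT phi -> (forall v, `|phi v| <= 1) ->
  `|\int[lebesgue_measure]_(v in `[a, +oo[) (phi v * expR (- x * v))| <= expR (- x * a) / x.
Proof.
move=> a0 x0 mphi bphi.
have iphi : lebesgue_measure.-integrable `[a, +oo[ (EFin \o (fun v => phi v * expR (- x * v))).
  apply: integrableS (laplace_integrable x0 mphi bphi) => //.
  by apply: subset_itvr; rewrite bnd_simp.
apply: le_trans (le_normr_Rintegral _ iphi) _ => //.
have -> : expR (- x * a) / x = \int[lebesgue_measure]_(v in `[a, +oo[) expR (- x * v).
  by rewrite /Rintegral integral_expR_tail.
apply: le_Rintegral => //.
- exact: integrable_norm iphi.
- exact: integrable_expR_tail.
- by move=> v _; rewrite normrM [X in _ * X]ger0_norm ?expR_ge0 // ler_piMl ?expR_ge0.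
Qed.

(** The fractional part jumps at [ln (n + 2)], so a closed formula is available only on the
    half-open interval. Endpoints do not affect the integrals, and on the closed interval the
    continuous [f] takes over. *)
Lemma laplace_tail_split (R : realType) (phi : R -> R) (n : nat) (x : R) (f : R -> R) : 0 < x ->
  measurable_fun setT phi -> (forall v, `|phi v| <= 1) -> continuous f ->
  (forall v, ln n.+1%:R <= v < ln n.+2%:R -> phi v * expR (- x * v) = f v) ->
  \int[lebesgue_measure]_(v in `[ln n.+1%:R, +oo[) (phi v * expR (- x * v))
  - \int[lebesgue_measure]_(v in `[ln n.+2%:R, +oo[) (phi v * expR (- x * v))
  = \int[lebesgue_measure]_(v in `[ln n.+1%:R, ln n.+2%:R]) f v.
Proof.
move=> x0 mphi bphi cf phif.
set a : R := ln n.+1%:R; set b : R := ln n.+2%:R.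
have a0 : 0 <= a by rewrite /a ln_ge0 // ler1n.
have ab : a <= b by rewrite /a /b ler_ln ?posrE // ler_nat.
have iphi := laplace_integrable x0 mphi bphi.
have ia : lebesgue_measure.-integrable `[a, +oo[ (EFin \o (fun v => phi v * expR (- x * v))).
  by apply: integrableS iphi => //; apply: subset_itvr; rewrite bnd_simp.
rewrite -(@Rintegral_itv_obnd_cbnd _ b); last first.
  by apply: integrableS ia => //; apply: subset_itvr; rewrite bnd_simp.
rewrite -(@Rintegral_itvB _ _ (BLeft a) +oo%O b) ?bnd_simp //; last first.
rewrite opprB addrCA subrr addr0.
rewrite -Rintegral_itv_bndo_bndc; last first.
  apply: integrableS (integrable_continuous_itv a b cf) => //.
  by apply: subset_itvl; rewrite bnd_simp.
rewrite -Rintegral_itv_bndo_bndc; last first.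
  by apply: integrableS ia => //; apply: subset_itvl; rewrite bnd_simp.
by apply: eq_Rintegral => v; rewrite inE /= in_itv /= => /phif.
Qed.

(** Between [ln (n + 1)] and [ln (n + 2)] the fractional part is [exp v - (n + 1)], which turns the
    integrand into [exp (- (s - 1) v) - (n + 1) exp (- s v)]. *)
Lemma zeta_tail_step (R : realType) (n : nat) (x u : R) : 0 < x ->
  zeta_tail (ln n.+1%:R) x u - zeta_tail (ln n.+2%:R) x u
  = expcis_integral (x - 1) u (ln n.+1%:R) (ln n.+2%:R)
    - n.+1%:R * expcis_integral x u (ln n.+1%:R) (ln n.+2%:R).
Proof.
move=> x0; set a : R := ln n.+1%:R; set b : R := ln n.+2%:R.
have eE (v : R) : expR (- (x - 1) * v) = expR v * expR (- x * v).
  by rewrite -expRD; congr expR; ring.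
have natC : n.+1%:R = (n.+1%:R : R)%:C%C by rewrite rmorph_nat.
have cc := continuous_expRM_cosM; have cs := continuous_expRM_sinM.
have cl (p : R) (f g : R -> R) : continuous f -> continuous g ->
    continuous (fun v => 1 * f v + p * g v).
  move=> cf cg v; apply: cvgD; apply: cvgM; try exact: cvg_cst.
    exact: cf.
  exact: cg.
have Hc := laplace_tail_split (phi := fun v => frac_exp v * cos (u * v)) (n := n) x0
  (measurable_frac_exp_cosM u) (frac_exp_cosM_le1 u)
  (cl (- n.+1%:R) _ _ (cc _ (- (x - 1)) u) (cc _ (- x) u)).
have Hs := laplace_tail_split (phi := fun v => frac_exp v * sin (u * v)) (n := n) x0
  (measurable_frac_exp_sinM u) (frac_exp_sinM_le1 u)
  (cl (- n.+1%:R) _ _ (cs _ (- (x - 1)) u) (cs _ (- x) u)).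
rewrite /zeta_tail /expcis_integral natC.
apply/eqP; rewrite eq_complex /=; apply/andP; split; apply/eqP.
  rewrite Hc => [|v /frac_expE ->]; last by rewrite eE; ring.
  by rewrite Rintegral_lin2 //; ring.
rewrite -opprD Hs => [|v /frac_expE ->]; last by rewrite eE; ring.
by rewrite Rintegral_lin2 //; ring.
Qed.

Lemma zeta_tail_line_analytic (R : realType) (u x0 : R) : 0 < x0 ->
  line_analytic (fun x => zeta_tail 0 x u) x0.
Proof.
move=> x0_gt0; apply/line_analytic_Re; split.
  have [c Hc] := laplace_analytic x0_gt0 (measurable_frac_exp_cosM u) (frac_exp_cosM_le1 u).
  exists c; apply/nbhs_ballP; exists x0 => //= h; rewrite /ball /= sub0r normrN.
  exact: Hc.
have [c Hc] := laplace_analytic x0_gt0 (measurable_frac_exp_sinM u) (frac_exp_sinM_le1 u).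
exists (fun k => - c k); apply/nbhs_ballP; exists x0 => //= h; rewrite /ball /= sub0r normrN.
move=> /Hc; rewrite /series /= => /cvgN; apply: cvg_trans; apply: near_eq_cvg.
by near=> n; under [RHS]eq_bigr do rewrite mulNr; rewrite sumrN.
Unshelve. all: by end_near. Qed.

(** The squared modulus as an element of [R]; the norm of [R[i]] takes its values in [R[i]]. *)
Definition sqnormc (R : realType) (z : R[i]) : R := complex.Re z ^+ 2 + complex.Im z ^+ 2.

Lemma sqnormc_ge0 (R : realType) (z : R[i]) : 0 <= sqnormc z.
Proof. by rewrite addr_ge0 ?sqr_ge0. Qed.

Lemma sqnormc_eq0 (R : realType) (z : R[i]) : sqnormc z = 0 -> z = 0.
Proof.
move/eqP; rewrite paddr_eq0 ?sqr_ge0 // !sqrf_eq0.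
by move=> zz; apply/eqP; rewrite eq_complex.
Qed.

Lemma sqnormcM (R : realType) (z w : R[i]) : sqnormc (z * w) = sqnormc z * sqnormc w.
Proof. by case: z w => [a b] [c d]; rewrite /sqnormc /=; ring. Qed.

Lemma sqnormcV (R : realType) (z : R[i]) : sqnormc z^-1 = (sqnormc z)^-1.
Proof.
have [->|z0] := eqVneq z 0; first by rewrite invr0 /sqnormc /= expr0n addr0 invr0.
have sz : sqnormc z != 0 by apply: contra z0 => /eqP/sqnormc_eq0 ->.
apply: (mulIf sz); rewrite mulVf // -sqnormcM mulVf //.
by rewrite /sqnormc /= expr0n expr1n addr0.
Qed.

Lemma sqnormcB_le (R : realType) (z w : R[i]) :
  sqnormc (z - w) <= 2 * sqnormc z + 2 * sqnormc w.
Proof.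
case: z w => [a b] [c d]; rewrite /sqnormc /= -subr_ge0.
rewrite (_ : _ - _ = (a + c) ^+ 2 + (b + d) ^+ 2); last ring.
by rewrite addr_ge0 ?sqr_ge0.
Qed.

Lemma sqnormc_cexp (R : realType) (z : R[i]) : sqnormc (cexp z) = expR (2 * complex.Re z).
Proof.
case: z => a b; rewrite /sqnormc /cexp /= !mul0r subr0 addr0.
by rewrite !exprMn -mulrDr cos2Dsin2 mulr1 expr2 -expRD; congr expR; ring.
Qed.

(** The first-order Euler-Maclaurin expression of length [n + 1] at [s = x + i u]. *)
Definition zeta_em (R : realType) (n : nat) (x u : R) : R[i] :=
  \sum_(0 <= k < n.+1) npow_opp k.+1 (x +i* u)%C
  + cexp ((1 - (x +i* u)%C) * (ln n.+1%:R)%:C%C) / ((x +i* u)%C - 1)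
  - (x +i* u)%C * zeta_tail (ln n.+1%:R) x u.

(** When the length grows by one, [s] times the change of the tail is explicit by [zeta_tail_step]
    and [mul_expcis_integral]; it cancels the new term of the sum and the change of the middle term.
    The condition on [u] makes [s - 1] invertible. *)
Lemma zeta_em_const (R : realType) (n : nat) (x u : R) : 0 < x -> u != 0 ->
  zeta_em n x u = zeta_em 0 x u.
Proof.
move=> x0 u0; elim: n => // n <-; rewrite /zeta_em big_nat_recr //=.
set S := \sum_(_ <= _ < _) _; set s := (x +i* u)%C.
have s1 : s - 1 != 0 by rewrite eq_complex /= subr0 negb_and u0 orbT.
have ab : ln n.+1%:R <= ln n.+2%:R :> R by rewrite ler_ln ?posrE // ler_nat.
have C1 := mul_expcis_integral x u ab.
have C2 := mul_expcis_integral (x - 1) u ab.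
have T := zeta_tail_step n u x0.
have sE : ((x - 1) +i* u)%C = s - 1 by apply/eqP; rewrite eq_complex /= subr0 !eqxx.
rewrite sE in C2; rewrite -/s in C1.
have cE (m : nat) : cexp ((1 - s) * (ln m.+1%:R)%:C%C) = m.+1%:R * cexp (- s * (ln m.+1%:R)%:C%C).
  by rewrite mulrDl mul1r cexpD cexp_real lnK ?posrE // rmorph_nat.
rewrite -(subrK (zeta_tail (ln n.+2%:R) x u) (zeta_tail (ln n.+1%:R) x u)) T.
have {}C2 : expcis_integral (x - 1) u (ln n.+1%:R) (ln n.+2%:R) =
    (cexp (- (s - 1) * (ln n.+1%:R)%:C%C) - cexp (- (s - 1) * (ln n.+2%:R)%:C%C)) / (s - 1).
  by rewrite -C2 mulrC mulKf.
rewrite {}C2 opprB /npow_opp !cE mulrDr mulrBr [s * (n.+1%:R * _)]mulrCA C1.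
set A := cexp _; set B := cexp _; set Z := zeta_tail _ _ _.
by rewrite -[n.+2%:R]natr1; field.
Qed.

(** Use [|s - 1| >= |u|] for the middle term and bound each component of the tail by
    [X ^ (- x) / x], with [X = n + 1]. The constant 4 is 2 from splitting the square times 2 for the
    two components. *)
Lemma zeta_em_error (R : realType) (n : nat) (x u : R) : 0 < x -> u != 0 ->
  sqnormc (zeta_em n x u - \sum_(0 <= k < n.+1) npow_opp k.+1 (x +i* u)%C)
  <= 2 * expR (2 * ((1 - x) * ln n.+1%:R)) / u ^+ 2
     + 4 * (x ^+ 2 + u ^+ 2) * expR (- (2 * x) * ln n.+1%:R) / x ^+ 2.
Proof.
move=> x0 u0; rewrite /zeta_em; set S := \sum_(_ <= _ < _) _.
set s := (x +i* u)%C; set A := cexp _ / _; set B := s * _.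
rewrite (_ : S + A - B - S = A - B); last by ring.
rewrite {}/A {}/B.
have L0 : 0 <= ln n.+1%:R :> R by rewrite ln_ge0 // ler1n.
apply: le_trans (sqnormcB_le _ _) _; apply: lerD.
  rewrite sqnormcM sqnormcV sqnormc_cexp ReM_real /= -mulrA.
  rewrite ler_wpM2l // ler_wpM2l ?expR_ge0 // lef_pV2.
  - by rewrite /sqnormc /= subr0 lerDr sqr_ge0.
  - by rewrite posrE /sqnormc /= subr0 ltr_wpDl ?sqr_ge0 // exprn_even_gt0.
  - by rewrite posrE exprn_even_gt0.
rewrite sqnormcM.
have -> : 4 * (x ^+ 2 + u ^+ 2) * expR (- (2 * x) * ln n.+1%:R) / x ^+ 2
    = 2 * ((x ^+ 2 + u ^+ 2) * (2 * (expR (- x * ln n.+1%:R) / x) ^+ 2)).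
  rewrite (_ : expR (- (2 * x) * _) = expR (- x * ln n.+1%:R) ^+ 2).
    by field; rewrite gt_eqF.
  by rewrite expr2 -expRD; congr expR; ring.
rewrite ler_wpM2l // ler_wpM2l //; first exact: sqnormc_ge0.
rewrite mulr2n mulrDl mul1r; apply: lerD => /=.
  rewrite -[leLHS]real_normK ?num_real // ler_pXn2r ?nnegrE ?divr_ge0 ?expR_ge0 ?(ltW x0) //.
  exact: laplace_tail_bound L0 x0 (measurable_frac_exp_cosM u) (frac_exp_cosM_le1 u).
rewrite sqrrN -[leLHS]real_normK ?num_real // ler_pXn2r ?nnegrE ?divr_ge0 ?expR_ge0 ?(ltW x0) //.
exact: laplace_tail_bound L0 x0 (measurable_frac_exp_sinM u) (frac_exp_sinM_le1 u).
Qed.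

Lemma ln_nat_cvgy (R : realType) : (fun n => ln (n.+1%:R : R)) @ \oo --> +oo.
Proof.
apply/cvgryPge => A; near=> n.
rewrite -[leLHS]expRK ler_ln ?posrE ?expR_gt0 //.
near: n; have : (fun n => n.+1%:R : R) @ \oo --> +oo.
  by rewrite (cvg_shiftS (fun n => n%:R : R)); exact: cvgr_idn.
by move/cvgryPge; apply.
Unshelve. all: by end_near. Qed.

Lemma expR_ln_nat_cvg0 (R : realType) (c : R) : 0 < c ->
  (fun n => expR (- c * ln n.+1%:R)) @ \oo --> 0.
Proof.
move=> c0; under eq_fun do rewrite mulNr.
apply: (@cvg_comp _ _ _ _ (fun z => expR (- (c * z))) _ (pinfty_nbhs R)).
  exact: ln_nat_cvgy.
apply: (@cvg_comp _ _ _ (fun z => c * z) (fun z => expR (- z)) _ (pinfty_nbhs R)).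
  exact: gt0_cvgMry.
exact: cvgr_expR.
Qed.

(** The expression does not depend on its length, and for [x > 1] its distance to the partial sums
    of the Dirichlet series tends to 0. *)
Lemma zeta_eq_zeta_em0 (R : realType) (zeta : R[i] -> R[i]) (x u : R) :
  is_riemann_zeta zeta -> 1 < x -> u != 0 -> zeta (x +i* u)%C = zeta_em 0 x u.
Proof.
move=> [zS _ _] x1 u0; have x0 : 0 < x by lra.
have /cvg_complexP[/= hR hI] := zS (x +i* u)%C x1.
apply/esym/eqP; rewrite -subr_eq0; apply/eqP/sqnormc_eq0.
set S := series _ in hR hI.
pose b n := 2 * expR (2 * ((1 - x) * ln n.+1%:R)) / u ^+ 2
     + 4 * (x ^+ 2 + u ^+ 2) * expR (- (2 * x) * ln n.+1%:R) / x ^+ 2.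
have Sb n : sqnormc (zeta_em 0 x u - S n.+1) <= b n.
  by rewrite -(zeta_em_const n x0 u0); exact: zeta_em_error.
have b0 : b @ \oo --> (0 : R).
  rewrite (_ : 0 = 2 * 0 / u ^+ 2 + 4 * (x ^+ 2 + u ^+ 2) * 0 / x ^+ 2); last by ring.
  apply: cvgD; apply: cvgM; try exact: cvg_cst; apply: cvgM; try exact: cvg_cst.
    rewrite (_ : (fun n => _) = fun n => expR (- (2 * (x - 1)) * ln n.+1%:R)).
      by apply: expR_ln_nat_cvg0; lra.
    by apply/funext => n; congr expR; ring.
  by apply: expR_ln_nat_cvg0; lra.
have Sl : (fun n => sqnormc (zeta_em 0 x u - S n.+1)) @ \oo --> sqnormc (zeta_em 0 x u - zeta (x +i* u)%C).
  rewrite /sqnormc; under eq_fun do rewrite !raddfB /=.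
  rewrite !raddfB /=; rewrite -(cvg_shiftS (fun n => complex.Re (S n))) in hR.
  rewrite -(cvg_shiftS (fun n => complex.Im (S n))) in hI.
  apply: cvgD; rewrite expr2; under eq_fun do rewrite expr2.
    by apply: cvgM; apply: cvgB; try exact: cvg_cst; exact: hR.
  by apply: cvgM; apply: cvgB; try exact: cvg_cst; exact: hI.
apply/le_anti; rewrite sqnormc_ge0 andbT.
by apply: (ler_cvg_to Sl b0); near=> n; exact: Sb.
Unshelve. all: by end_near.
Qed.

(** A horizontal line with [u != 0] avoids the pole, so the identity theorem on [x > 0] extends the
    equality known for [x > 1]. *)
Lemma zeta_eq_zeta_em (R : realType) (zeta : R[i] -> R[i]) (n : nat) (x u : R) :
  is_riemann_zeta zeta -> 0 < x -> u != 0 -> zeta (x +i* u)%C = zeta_em n x u.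
Proof.
move=> zP x0 u0; rewrite zeta_em_const //.
have s1 (y : R) : (y +i* u)%C - 1 != 0 by rewrite eq_complex /= subr0 negb_and u0 orbT.
(* The factor [s - 1] clears the denominator in [zeta_em]. *)
pose w : R[i] := (0 +i* u)%C.
pose g (y : R) : R[i] := (y%:C%C + (w - 1)) * (zeta (y +i* u)%C + (y%:C%C + w) * zeta_tail 0 y u)
   + ((y%:C%C + w) * - 1).
have sE (y : R) : y%:C%C + w = (y +i* u)%C.
  by apply/eqP; rewrite eq_complex /= addr0 add0r !eqxx.
have gE (y : R) : g y = ((y +i* u)%C - 1) * (zeta (y +i* u)%C - zeta_em 0 y u).
  rewrite /g /zeta_em addrA sE big_nat1 ln1 mulr0 cexp0 /npow_opp ln1 mulr0 cexp0.
  by field; exact: s1.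
suff : g x = 0.
  by rewrite gE => /eqP; rewrite mulf_eq0 (negPf (s1 x)) /= subr_eq0 => /eqP.
apply: (line_analytic_identity _ _ x0) => y y_gt; last first.
  by rewrite gE zeta_eq_zeta_em0 // subrr mulr0.
apply: line_analyticD; last by apply: line_analytic_mul; exact: line_analytic_cst.
apply: line_analytic_mul; apply: line_analyticD.
  apply: line_analytic_horizontal; case: zP => _ _; apply.
  by rewrite eq_complex /= negb_and u0 orbT.
by apply: line_analytic_mul; exact: zeta_tail_line_analytic.
Qed.

(** * Mean square of the off-diagonal terms *)

Lemma continuous_cos_affine (R : realType) (p c : R) :
  continuous (fun a : R => cos (p + c * a)).
Proof.
move=> a; apply: continuous_comp; last exact: continuous_cos.
by apply: cvgD; [exact: cvg_cst|apply: cvgM; [exact: cvg_cst|exact: cvg_id]].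
Qed.

Lemma norm_integral_cos_le (R : realType) (p c M : R) : 0 <= M ->
  `|\int[lebesgue_measure]_(a in `[0, M]) cos (p + c * a)| <= M.
Proof.
move=> M0; apply: le_trans (le_normr_Rintegral _ _) _ => //.
  exact: integrable_continuous_itv (@continuous_cos_affine _ p c).
apply: (@le_trans _ _ (\int[lebesgue_measure]_(a in `[0, M]) (1 : R))).
  apply: le_Rintegral => //.
  - exact: integrable_norm (integrable_continuous_itv 0 M (@continuous_cos_affine _ p c)).
  - by apply: (integrable_continuous_itv 0 M (f := fun=> 1)) => a; exact: cvg_cst.
  - by move=> a _; rewrite ler_norml cos_geN1 cos_le1.
rewrite (@Rintegral_FTC _ (fun=> 1) id) //; last by move=> a; exact: cvg_cst.
by rewrite subr0.
Qed.

Lemma norm_integral_cos_le_inv (R : realType) (p c M : R) : 0 <= M -> c != 0 ->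
  `|\int[lebesgue_measure]_(a in `[0, M]) cos (p + c * a)| <= 2 / `|c|.
Proof.
move=> M0 c0.
have dS (a : R) : is_derive a 1 (fun a : R => c^-1 * sin (p + c * a)) (cos (p + c * a)).
  have := @is_derive1_comp R sin (fun v => p + c * v) a _ _ (is_derive_sin _) (is_derive_affine p c a).
  move/(is_derive_scale c^-1) => h; apply: (is_derive_eq h).
  by rewrite mulrCA mulVf // mulr1.
rewrite (Rintegral_FTC M0 (@continuous_cos_affine _ p c) dS) -mulrBr normrM normfV mulrC.
rewrite ler_wpM2r // ?invr_ge0 //; apply: le_trans (ler_normB _ _) _.
by rewrite (_ : 2 = 1 + 1) //; apply: lerD; rewrite ler_norml sin_geN1 sin_le1.
Qed.

(** For [y <= x], [x ^ (d + 1) - y ^ (d + 1) - (x - y)] equals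
    [y (x ^ d - y ^ d) + (x - y) (x ^ d - 1)], a sum of nonnegative terms. *)
Lemma ler_sub_exprn (R : realType) (d : nat) (x y : R) : (0 < d)%N -> 1 <= x -> 1 <= y ->
  `|x - y| <= `|x ^+ d - y ^+ d|.
Proof.
move=> d0; wlog yx : x y / y <= x.
  by move=> H x1 y1; have [yx|/ltW xy] := leP y x; [exact: H|rewrite distrC [leRHS]distrC; exact: H].
move=> x1 y1; case: d d0 => // d _.
have yxd : y ^+ d <= x ^+ d by rewrite lerXn2r ?nnegrE //; lra.
have xd : 1 <= x ^+ d by rewrite exprn_ege1.
have y0 : 0 <= y * (x ^+ d - y ^+ d) by rewrite mulr_ge0 ?subr_ge0 //; lra.
have z0 : 0 <= (x - y) * (x ^+ d - 1) by rewrite mulr_ge0 ?subr_ge0 //; lra.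
rewrite ger0_norm ?subr_ge0 //; apply: le_trans (ler_norm _).
by rewrite !exprS; move: y0 z0; rewrite !mulrBr !mulrBl; lra.
Qed.

(* For [n = m] the last term is [0^-1 = 0]. *)
Lemma integral_cos_cos_le (R : realType) (t c M : R) (d n m : nat) : (0 < d)%N ->
  0 <= M -> c != 0 ->
  \int[lebesgue_measure]_(a in `[0, M])
     (cos ((t + a * n.+1%:R ^+ d) * c) * cos ((t + a * m.+1%:R ^+ d) * c))
  <= M * (n == m)%:R + 2 * `|c|^-1 * `|n%:R - m%:R|^-1.
Proof.
move=> d0 M0 c0; set P : R := n.+1%:R ^+ d; set Q : R := m.+1%:R ^+ d.
(* Product to sum, with both cosines in the form [cos (p + c * a)]; the first phase is
   [t * c - t * c] for that reason. *)
under eq_Rintegral => a _.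
  rewrite (_ : _ * _ = 2^-1 * cos (t * c - t * c + (c * (P - Q)) * a)
                     + 2^-1 * cos (t * c + t * c + (c * (P + Q)) * a)); last first.
    rewrite (_ : t * c - t * c + _ = (t + a * P) * c - (t + a * Q) * c); last ring.
    rewrite (_ : t * c + t * c + _ = (t + a * P) * c + (t + a * Q) * c); last ring.
    by rewrite cosB cosD; field.
  over.
rewrite Rintegral_lin2; [|exact: continuous_cos_affine..].
set I := Rintegral _ _ _; set J := Rintegral _ _ _.
(* Both integrals obey the same bound: the trivial one [M] if [n = m], and otherwise the oscillatory
   one, because [|P + Q| >= |P - Q| >= |n - m|]. *)
suff [hI hJ] : `|I| <= M * (n == m)%:R + 2 * `|c|^-1 * `|n%:R - m%:R|^-1 /\
   `|J| <= M * (n == m)%:R + 2 * `|c|^-1 * `|n%:R - m%:R|^-1.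
  by have := ler_norm I; have := ler_norm J; lra.
have [->|nm] := eqVneq n m.
  by rewrite subrr normr0 invr0 mulr0 addr0 mulr1; split; exact: norm_integral_cos_le.
rewrite mulr0 add0r.
have P1 : 1 <= n.+1%:R :> R by rewrite ler1n.
have Q1 : 1 <= m.+1%:R :> R by rewrite ler1n.
have nm0 : 0 < `|n%:R - m%:R| :> R by rewrite normr_gt0 subr_eq0 eqr_nat.
have hB : `|n%:R - m%:R| <= `|P - Q|.
  by rewrite (_ : n%:R - m%:R = n.+1%:R - m.+1%:R) ?ler_sub_exprn // -!natr1; ring.
have hD : `|n%:R - m%:R| <= `|P + Q|.
  apply: le_trans hB _; rewrite [leRHS]ger0_norm ?addr_ge0 ?exprn_ge0 //.
  rewrite ler_norml; have := exprn_ge0 d (le_trans ler01 P1); have := exprn_ge0 d (le_trans ler01 Q1).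
  by rewrite -/P -/Q; lra.
have B0 : 0 < `|P - Q| by exact: lt_le_trans hB.
have D0 : 0 < `|P + Q| by exact: lt_le_trans hD.
split; (apply: le_trans (norm_integral_cos_le_inv _ M0 _) _;
  first by rewrite mulf_neq0 // -normr_gt0).
  by rewrite normrM invfM mulrA ler_wpM2l ?mulr_ge0 ?invr_ge0 // lef_pV2.
by rewrite normrM invfM mulrA ler_wpM2l ?mulr_ge0 ?invr_ge0 // lef_pV2.
Qed.

(** Weighted Cauchy-Schwarz: twice the difference of the two sides is the double sum of
    [c i * c j * (g i - g j) ^ 2]. *)
Lemma sqr_sum_le (R : realType) (I : Type) (s : seq I) (c g : I -> R) :
  (forall i, 0 <= c i) ->
  (\sum_(i <- s) c i * g i) ^+ 2 <= (\sum_(i <- s) c i) * (\sum_(i <- s) c i * g i ^+ 2).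
Proof.
move=> c0.
have E : (\sum_(i <- s) c i * g i) ^+ 2 = \sum_(i <- s) \sum_(j <- s) (c i * g i) * (c j * g j).
  by rewrite expr2 mulr_suml; apply: eq_bigr => i _; rewrite mulr_sumr.
have F : (\sum_(i <- s) c i) * (\sum_(i <- s) c i * g i ^+ 2)
    = \sum_(i <- s) \sum_(j <- s) c i * (c j * g j ^+ 2).
  by rewrite mulr_suml; apply: eq_bigr => i _; rewrite mulr_sumr.
have F' : (\sum_(i <- s) c i) * (\sum_(i <- s) c i * g i ^+ 2)
    = \sum_(i <- s) \sum_(j <- s) c j * (c i * g i ^+ 2).
  by rewrite F exchange_big.
suff : 2 * (\sum_(i <- s) c i * g i) ^+ 2
     <= 2 * ((\sum_(i <- s) c i) * (\sum_(i <- s) c i * g i ^+ 2)) by rewrite ler_pM2l.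
set A := _ * _ in F F' *; have -> : 2 * A = A + A by ring.
rewrite [X in _ <= X + _]F [X in _ <= _ + X]F' -big_split /= E mulr_sumr; apply: ler_sum => i _.
rewrite -big_split /= mulr_sumr; apply: ler_sum => j _.
rewrite -subr_ge0 (_ : _ - _ = c i * c j * (g i - g j) ^+ 2); last ring.
by rewrite mulr_ge0 ?sqr_ge0 // mulr_ge0.
Qed.

Lemma continuous_sum (R : realType) (I : Type) (s : seq I) (f : I -> R -> R) :
  (forall i, continuous (f i)) -> continuous (fun x => \sum_(i <- s) f i x).
Proof.
move=> cf; elim: s => [|i s IH] x.
  by under eq_fun do rewrite big_nil; exact: cvg_cst.
rewrite /continuous_at big_cons; under eq_fun do rewrite big_cons.
by apply: cvgD; [exact: cf|exact: IH].
Qed.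

Definition harmonic_sum (R : realType) (n : nat) : R := \sum_(0 <= k < n) k.+1%:R^-1.

Lemma harmonic_sum_ge0 (R : realType) (n : nat) : 0 <= harmonic_sum R n.
Proof. by apply: sumr_ge0 => k _; rewrite invr_ge0. Qed.

Lemma harmonic_sum_le (R : realType) (m n : nat) : (m <= n)%N ->
  harmonic_sum R m <= harmonic_sum R n.
Proof.
move=> mn; rewrite /harmonic_sum (big_cat_nat (leq0n m) mn) //= lerDl.
by apply: sumr_ge0 => k _; rewrite invr_ge0.
Qed.

Lemma ln_sub_ge (R : realType) (x y : R) : 0 < x -> 0 < y -> (x - y) / x <= ln x - ln y.
Proof.
move=> x0 y0.
have y1 : -1 < y / x - 1 by rewrite ltrBrDr addNr divr_gt0.
have := le_ln1Dx y1; rewrite addrC subrK ln_div ?posrE //.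
by rewrite mulrBl divff ?gt_eqF //; lra.
Qed.

Lemma harmonic_sum_ln (R : realType) (n : nat) : harmonic_sum R n.+1 <= 1 + ln n.+1%:R.
Proof.
elim: n => [|n IH]; first by rewrite /harmonic_sum big_nat1 ln1 addr0 invr1.
rewrite /harmonic_sum big_nat_recr //= -/(harmonic_sum R n.+1).
have : (n.+2%:R - n.+1%:R) / n.+2%:R <= ln n.+2%:R - ln n.+1%:R :> R by exact: ln_sub_ge.
by rewrite -natr1 [X in X / _](_ : _ = 1) ?mul1r; [lra|ring].
Qed.

(* The term [l = k] is [0^-1 = 0]. *)
Lemma sum_inv_dist_le (R : realType) (k n : nat) : (k < n)%N ->
  \sum_(0 <= l < n) `|k%:R - l%:R|^-1 <= 2 * harmonic_sum R n.
Proof.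
move=> kn; rewrite (big_cat_nat (leq0n k) (ltnW kn)) //= mulr2n mulrDl mul1r; apply: lerD.
  (* Below [k] the distances, read backwards, are [1, ..., k]; above [k] they are
     [1, ..., n - k - 1]. *)
  rewrite big_nat_rev /= add0n; apply: le_trans (harmonic_sum_le R (ltnW kn)).
  apply: ler_sum_nat => l /andP[_ lk].
  rewrite natrB // (_ : _ - _ = l.+1%:R) ?ger0_norm //; last by ring.
rewrite big_ltn // subrr normr0 invr0 add0r.
rewrite -{1}(add0n k.+1) big_addn; apply: le_trans (harmonic_sum_le R (leq_subr k.+1 n)).
apply: ler_sum_nat => l _.
rewrite natrD (_ : _ - _ = - l.+1%:R) ?normrN ?ger0_norm //.
by rewrite -[k.+1%:R]natr1 -[l.+1%:R]natr1; ring.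
Qed.

(** Expand the square. Each of the [N] pairs [n = m] contributes at most [M], and for fixed [n] the
    others are summed by [sum_inv_dist_le]. *)
Lemma integral_sqr_sum_cos_le (R : realType) (t c M : R) (d N : nat) : (0 < d)%N ->
  0 <= M -> c != 0 ->
  \int[lebesgue_measure]_(a in `[0, M])
     (\sum_(0 <= n < N) cos ((t + a * n.+1%:R ^+ d) * c)) ^+ 2
  <= N%:R * (M + 4 * harmonic_sum R N * `|c|^-1).
Proof.
move=> d0 M0 c0.
have cc (n : nat) : continuous (fun a : R => cos ((t + a * n.+1%:R ^+ d) * c)).
  rewrite (_ : (fun a => _) = fun a => cos (t * c + n.+1%:R ^+ d * c * a)).
    exact: continuous_cos_affine.
  by apply/funext => a; congr cos; ring.
have ccm (n m : nat) : continuous (fun a : R =>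
    cos ((t + a * n.+1%:R ^+ d) * c) * cos ((t + a * m.+1%:R ^+ d) * c)).
  by move=> a; apply: cvgM; exact: cc.
under eq_Rintegral => a _.
  rewrite expr2 mulr_suml; under eq_bigr do rewrite mulr_sumr.
  over.
rewrite Rintegral_sum // => [|n]; last first.
  by apply: integrable_continuous_itv; apply: continuous_sum => m; exact: ccm.
have -> : N%:R * (M + 4 * harmonic_sum R N * `|c|^-1)
    = \sum_(0 <= n < N) (M + 4 * harmonic_sum R N * `|c|^-1).
  by rewrite big_const_nat iter_addr addr0 subn0 mulr_natl.
apply: ler_sum_nat => n /andP[_ nN].
rewrite Rintegral_sum // => [|m]; last exact: integrable_continuous_itv.
apply: le_trans (ler_sum _ (fun m _ => integral_cos_cos_le t n m d0 M0 c0)) _.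
rewrite big_split /= -!mulr_sumr; apply: lerD.
  rewrite ler_piMr // -natr_sum lern1.
  rewrite (bigD1_seq n) ?mem_index_iota ?iota_uniq //= eqxx big1 // => m.
  by rewrite eq_sym => /negPf ->.
rewrite (_ : 4 * _ / _ = 2 * `|c|^-1 * (2 * harmonic_sum R N)); last by ring.
by rewrite ler_wpM2l ?mulr_ge0 ?invr_ge0 //; exact: sum_inv_dist_le.
Qed.

(* The coefficient of the pair [(k + 1, l + 1)]; zero on the diagonal, so that sums
   over all pairs can be used. *)
Definition cross_weight (R : realType) (x : R) (k l : nat) : R :=
  if k == l then 0 else expR (- x * ln k.+1%:R) * expR (- x * ln l.+1%:R).

(** The part of [|P (x + i u)| ^ 2] coming from distinct indices, [P] being the Dirichlet polynomial
    of length [X]. *)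
Definition off_diagonal (R : realType) (X : nat) (x u : R) : R :=
  \sum_(0 <= k < X) \sum_(0 <= l < X)
    cross_weight x k l * cos (u * (ln k.+1%:R - ln l.+1%:R)).

Lemma cross_weight_ge0 (R : realType) (x : R) (k l : nat) : 0 <= cross_weight x k l.
Proof. by rewrite /cross_weight; case: eqP => // _; rewrite mulr_ge0 ?expR_ge0. Qed.

Lemma sqnormc_dirichlet (R : realType) (X : nat) (x u : R) :
  sqnormc (\sum_(0 <= k < X) npow_opp k.+1 (x +i* u)%C)
  = \sum_(0 <= k < X) expR (- (2 * x) * ln k.+1%:R) + off_diagonal X x u.
Proof.
have -> : sqnormc (\sum_(0 <= k < X) npow_opp k.+1 (x +i* u)%C)
    = \sum_(0 <= k < X) \sum_(0 <= l < X) expR (- x * ln k.+1%:R) * expR (- x * ln l.+1%:R)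
        * cos (u * (ln k.+1%:R - ln l.+1%:R)).
  rewrite /sqnormc !raddf_sum.
  under eq_bigr do rewrite /npow_opp cexpNM /=.
  under [X in _ + X ^+ 2]eq_bigr do rewrite /npow_opp cexpNM /=.
  rewrite sumrN sqrrN !expr2 !mulr_suml -big_split /=; apply: eq_bigr => k _.
  rewrite !mulr_sumr -big_split /=; apply: eq_bigr => l _.
  by rewrite mulrBr cosB; ring.
rewrite /off_diagonal -big_split /=; apply: eq_big_nat => k /andP[_ kX].
rewrite (bigD1_seq k) ?mem_index_iota ?iota_uniq //=.
rewrite [in RHS](bigD1_seq k) ?mem_index_iota ?iota_uniq //=.
rewrite {1}/cross_weight eqxx mul0r add0r subrr mulr0 cos0 mulr1 -expRD; congr (expR _ + _).
  by ring.
by apply: eq_bigr => l lk; rewrite /cross_weight eq_sym (negPf lk).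
Qed.

(** Cauchy-Schwarz with weights [cross_weight] over the pairs brings the square onto the mean over
    [n] for a single pair. There [integral_sqr_sum_cos_le] applies with frequency
    [ln ((k + 1) / (l + 1))]. *)
Lemma integral_mean_off_diagonal_le (R : realType) (t x M : R) (d N X : nat) :
  (0 < d)%N -> (0 < N)%N -> 0 <= M ->
  \int[lebesgue_measure]_(a in `[0, M])
     (N%:R^-1 * \sum_(0 <= n < N) off_diagonal X x (t + a * n.+1%:R ^+ d)) ^+ 2
  <= N%:R^-1 * (\sum_(0 <= k < X) \sum_(0 <= l < X) cross_weight x k l)
     * (M * (\sum_(0 <= k < X) \sum_(0 <= l < X) cross_weight x k l)
        + 4 * harmonic_sum R N * (\sum_(0 <= k < X) \sum_(0 <= l < X)
              cross_weight x k l * `|ln k.+1%:R - ln l.+1%:R|^-1)).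
Proof.
move=> d0 N0 M0; have NR : 0 < N%:R :> R by rewrite ltr0n.
pose s := [seq (k, l) | k <- index_iota 0 X, l <- index_iota 0 X].
pose c (p : nat * nat) : R := cross_weight x p.1 p.2.
pose e (p : nat * nat) : R := ln p.1.+1%:R - ln p.2.+1%:R.
pose g p (a : R) : R := N%:R^-1 * \sum_(0 <= n < N) cos ((t + a * n.+1%:R ^+ d) * e p).
have c0 p : 0 <= c p by exact: cross_weight_ge0.
have pairsE (F : nat -> nat -> R) :
    \sum_(0 <= k < X) \sum_(0 <= l < X) F k l = \sum_(p <- s) F p.1 p.2.
  by rewrite /s big_allpairs.
have GE (a : R) : N%:R^-1 * \sum_(0 <= n < N) off_diagonal X x (t + a * n.+1%:R ^+ d)
    = \sum_(p <- s) c p * g p a.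
  under eq_bigr do rewrite /off_diagonal pairsE.
  rewrite exchange_big /= mulr_sumr; apply: eq_bigr => p _.
  by rewrite -mulr_sumr mulrCA.
have cosc (p : nat * nat) (n : nat) : continuous (fun a : R => cos ((t + a * n.+1%:R ^+ d) * e p)).
  rewrite (_ : (fun a => _) = fun a => cos (t * e p + n.+1%:R ^+ d * e p * a)).
    exact: continuous_cos_affine.
  by apply/funext => a; congr cos; ring.
have scal (r : R) (f : R -> R) : continuous f -> continuous (fun a => r * f a).
  by move=> cf a; apply: cvgM; [exact: cvg_cst|exact: cf].
have sqc (f : R -> R) : continuous f -> continuous (fun a => f a ^+ 2).
  by move=> cf a; apply: cvgM; exact: cf.
have gc p : continuous (g p) by apply: (scal); apply: continuous_sum => n; exact: cosc.
rewrite !pairsE; under eq_Rintegral => a _ do rewrite GE.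
pose S0 := \sum_(p <- s) c p; rewrite -/S0.
have S00 : 0 <= S0 by apply: sumr_ge0.
apply: (@le_trans _ _ (\int[lebesgue_measure]_(a in `[0, M]) (S0 * \sum_(p <- s) c p * g p a ^+ 2))).
  apply: le_Rintegral => //.
  - apply: integrable_continuous_itv; apply: (sqc); apply: continuous_sum => p.
    exact: scal.
  - apply: integrable_continuous_itv; apply: (scal); apply: continuous_sum => p.
    by apply: (scal); exact: sqc.
  - by move=> a _; exact: sqr_sum_le.
rewrite RintegralZl //; last first.
  apply: integrable_continuous_itv; apply: continuous_sum => p.
  by apply: (scal); exact: sqc.
rewrite Rintegral_sum // => [|p]; last first.
  by apply: integrable_continuous_itv; apply: (scal); exact: sqc.
rewrite -mulrA mulrCA ler_wpM2l //.
rewrite /S0 [M * _]mulr_sumr [X in _ + X]mulr_sumr -big_split /= mulr_sumr.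
apply: ler_sum => p _.
rewrite RintegralZl //; last by apply: integrable_continuous_itv; exact: sqc.
(* On the diagonal the frequency vanishes, but so does the weight. *)
have [p12|p12] := eqVneq p.1 p.2.
  by rewrite /c /cross_weight p12 eqxx !(mul0r, mulr0) addr0 mulr0.
have e0 : e p != 0.
  rewrite subr_eq0; apply: contra p12 => /eqP/ln_inj; rewrite !posrE.
  by move=> /(_ (ltr0Sn _ _) (ltr0Sn _ _))/eqP; rewrite eqr_nat eqSS.
rewrite (_ : N%:R^-1 * _ = c p * (N%:R^-1 * (M + 4 * harmonic_sum R N * `|e p|^-1))); last first.
  by rewrite /e /c; ring.
rewrite ler_wpM2l //.
under eq_Rintegral do rewrite /g exprMn.
rewrite RintegralZl //; last first.
  by apply: integrable_continuous_itv; apply: (sqc); apply: continuous_sum => n; exact: cosc.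
apply: le_trans (ler_wpM2l (sqr_ge0 _) (integral_sqr_sum_cos_le t N d0 M0 e0)) _.
by rewrite mulrA expr2 -(mulrA N%:R^-1) mulVf ?mulr1 // gt_eqF.
Qed.

(** The factor [J] pays for replacing [k ^ (- x)] by [1 / k]; the weights are then dominated by a
    product and the double sum factors. *)
Lemma sum_cross_weight_le (R : realType) (x J : R) (X : nat) :
  (forall k, (k < X)%N -> expR (- x * ln k.+1%:R) <= J * k.+1%:R^-1) ->
  \sum_(0 <= k < X) \sum_(0 <= l < X) cross_weight x k l <= (J * harmonic_sum R X) ^+ 2.
Proof.
move=> HJ; rewrite expr2 [X in X * _]mulr_sumr mulr_suml; apply: ler_sum_nat => k /andP[_ kX].
rewrite [X in _ * X]mulr_sumr mulr_sumr; apply: ler_sum_nat => l /andP[_ lX].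
have := HJ _ kX; have := HJ _ lX; move=> hl hk.
have k0 := le_trans (expR_ge0 _) hk; have l0 := le_trans (expR_ge0 _) hl.
rewrite /cross_weight; case: eqP => _; first by rewrite mulr_ge0.
by apply: ler_pM; rewrite ?expR_ge0.
Qed.

(** From [ln k - ln l >= (k - l) / k] for the larger index [k]. The symmetric factor [k + l] is
    chosen because [(k + l) / (k l) = 1 / k + 1 / l]. *)
Lemma inv_dist_ln_le (R : realType) (k l : nat) : k != l ->
  `|ln k.+1%:R - ln l.+1%:R|^-1 <= (k.+1%:R + l.+1%:R) * `|k%:R - l%:R|^-1 :> R.
Proof.
wlog lk : k l / (l < k)%N.
  move=> H kl; have [|kl'|] := ltngtP l k.
  - by move=> /H; apply.
  - by rewrite distrC [X in _ <= _ * X^-1]distrC [k.+1%:R + _]addrC; apply: H; rewrite // eq_sym.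
  - by move=> lk; rewrite lk eqxx in kl.
move=> _; have lkR : l%:R < k%:R :> R by rewrite ltr_nat.
have h := ln_sub_ge (ltr0Sn R k) (ltr0Sn R l).
have D : k.+1%:R - l.+1%:R = k%:R - l%:R :> R by rewrite -[k.+1%:R]natr1 -[l.+1%:R]natr1; ring.
rewrite D in h.
have h0 : 0 < (k%:R - l%:R) / k.+1%:R :> R by rewrite divr_gt0 // subr_gt0.
rewrite ger0_norm ?(le_trans (ltW h0)) // [X in _ <= _ * X^-1]ger0_norm ?subr_ge0 ?(ltW lkR) //.
apply: (@le_trans _ _ (k.+1%:R * (k%:R - l%:R)^-1)); last first.
  by rewrite ler_wpM2r ?invr_ge0 ?subr_ge0 ?(ltW lkR) // lerDl.
rewrite -invf_div lef_pV2 // ?posrE //; exact: lt_le_trans h.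
Qed.

(** By [inv_dist_ln_le] each term is at most [J ^ 2 (1 / k + 1 / l) / |k - l|]. The two halves have
    equal sums by symmetry, and each is bounded by summing first over the distances. *)
Lemma sum_cross_weight_inv_le (R : realType) (x J : R) (X : nat) :
  (forall k, (k < X)%N -> expR (- x * ln k.+1%:R) <= J * k.+1%:R^-1) ->
  \sum_(0 <= k < X) \sum_(0 <= l < X) cross_weight x k l * `|ln k.+1%:R - ln l.+1%:R|^-1
  <= 4 * (J * harmonic_sum R X) ^+ 2.
Proof.
move=> HJ.
have T (k : nat) (l : nat) : (k < X)%N -> (l < X)%N ->
    cross_weight x k l * `|ln k.+1%:R - ln l.+1%:R|^-1
    <= J ^+ 2 * (k.+1%:R^-1 * `|k%:R - l%:R|^-1) + J ^+ 2 * (l.+1%:R^-1 * `|l%:R - k%:R|^-1).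
  move=> kX lX; rewrite (distrC l%:R) -mulrDr -mulrDl.
  rewrite /cross_weight; case: (altP eqP) => [->|kl].
    by rewrite mul0r mulr_ge0 ?sqr_ge0 // mulr_ge0 ?addr_ge0 ?invr_ge0.
  apply: le_trans (ler_pM _ _ (ler_pM _ _ (HJ _ kX) (HJ _ lX)) (inv_dist_ln_le R kl)) _;
    rewrite ?mulr_ge0 ?expR_ge0 ?invr_ge0 //.
  rewrite le_eqVlt; apply/orP; left; apply/eqP.
  by field; rewrite normr_eq0 subr_eq0 eqr_nat kl !nat1r !pnatr_eq0.
pose A := \sum_(0 <= k < X) \sum_(0 <= l < X) J ^+ 2 * (k.+1%:R^-1 * `|k%:R - l%:R|^-1).
apply: (@le_trans _ _ (A + A)).
  have -> : A + A = A + \sum_(0 <= k < X) \sum_(0 <= l < X) J ^+ 2 * (l.+1%:R^-1 * `|l%:R - k%:R|^-1).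
    by rewrite [X in _ = _ + X]exchange_big.
  rewrite -big_split /=; apply: ler_sum_nat => k /andP[_ kX].
  by rewrite -big_split /=; apply: ler_sum_nat => l /andP[_ lX]; exact: T.
have : A <= 2 * (J * harmonic_sum R X) ^+ 2; last lra.
rewrite (_ : 2 * _ = J ^+ 2 * (harmonic_sum R X * (2 * harmonic_sum R X))); last ring.
rewrite [in leRHS]/harmonic_sum mulr_suml mulr_sumr; apply: ler_sum_nat => k /andP[_ kX].
rewrite -!mulr_sumr ler_wpM2l ?sqr_ge0 // ler_wpM2l ?invr_ge0 //.
exact: sum_inv_dist_le.
Qed.

(** * From summable mean squares to convergence almost everywhere *)

Lemma sum_inv_sqr_le2 (R : realType) (n : nat) : \sum_(0 <= j < n) j.+1%:R ^- 2 <= 2 :> R.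
Proof.
(* The sharper bound is inductive: [1 / (m + 2) ^ 2 <= 1 / (m + 1) - 1 / (m + 2)]. *)
suff H m : \sum_(0 <= j < m.+1) j.+1%:R ^- 2 <= 2 - m.+1%:R^-1 :> R.
  case: n => [|n]; first by rewrite big_geq.
  by apply: le_trans (H n) _; rewrite gerBl invr_ge0.
elim: m => [|m IH]; first by rewrite big_nat1 expr1n invr1; lra.
rewrite big_nat_recr //=; apply: le_trans (lerD IH (lexx _)) _.
have m1 : 0 < m.+1%:R :> R by [].
have m2 : m.+2%:R = m.+1%:R + 1 :> R by rewrite natr1.
rewrite -subr_ge0 m2; set y : R := m.+1%:R in m1 *.
rewrite (_ : _ - _ = (y * (y + 1) ^+ 2)^-1); first by rewrite invr_ge0 mulr_ge0 ?exprn_ge0 //; lra.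
by field; rewrite !gt_eqF //; lra.
Qed.

(** The integrals of the squares are summable, so the sum of the squares is integrable, hence finite
    almost everywhere, and its terms tend to 0 there. *)
Lemma ae_cvg0_of_integral_sqr (R : realType) (f : nat -> R -> R) (M C : R) :
  (forall j, continuous (f j)) ->
  (forall j, \int[lebesgue_measure]_(a in `[0, M]) (f j a) ^+ 2 <= C * j.+1%:R ^- 2) ->
  {ae (@lebesgue_measure R), forall a, 0 <= a <= M -> (fun j => f j a) @ \oo --> (0 : R)}.
Proof.
move=> cf fC.
have cf2 j : continuous (fun a => f j a ^+ 2) by move=> a; apply: cvgM; exact: cf.
have C0 : 0 <= C.
  have := fC 0; rewrite expr1n invr1 mulr1; apply: le_trans.
  by apply: Rintegral_ge0 => a _; rewrite sqr_ge0.
pose g j (a : R) : \bar R := (f j a ^+ 2)%:E.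
have g0 j a : (0 <= g j a)%E by rewrite lee_fin sqr_ge0.
pose D := `[0, M]%classic : set (measurableTypeR R).
have mD : measurable D by exact: measurable_itv.
have mg j : measurable_fun D (g j).
  by apply/measurable_EFinP; apply: measurable_funTS; exact: continuous_measurable_fun.
have ig j : (\int[lebesgue_measure]_(a in D) g j a <= (C * j.+1%:R ^- 2)%:E)%E.
  rewrite -[leLHS]fineK ?lee_fin; first exact: fC.
  apply: integrable_fin_num; first exact: mD.
  exact: (integrable_continuous_itv 0 M (cf2 j)).
have isum : (\int[lebesgue_measure]_(a in D) (\sum_(0 <= j <oo) g j a) <= (C * 2)%:E)%E.
  rewrite (integral_nneseries _ mD) //; apply: lime_le.
    by apply: is_cvg_nneseries => j _ _; apply: integral_ge0.
  near=> n; apply: (@le_trans _ _ (\sum_(0 <= j < n) (C * j.+1%:R ^- 2)%:E)%E).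
    by apply: lee_sum => j _; exact: ig.
  by rewrite sumEFin lee_fin -mulr_sumr ler_wpM2l // sum_inv_sqr_le2.
have sum0 a : (0 <= \sum_(0 <= j <oo) g j a)%E by apply: nneseries_ge0.
have int : lebesgue_measure.-integrable D (fun a => \sum_(0 <= j <oo) g j a)%E.
  apply/integrableP; split; first exact: ge0_emeasurable_sum.
  under eq_integral do rewrite gee0_abs //.
  by apply: le_lt_trans isum _; exact: ltry.
have := integrable_ae mD int; apply: filterS => a H aM.
have fin := H aM.
have cs : cvgn (series (fun j => f j a ^+ 2)).
  apply: nondecreasing_is_cvgn.
    by apply: nondecreasing_series => j _ _; exact: sqr_ge0.
  exists (fine (\sum_(0 <= j <oo) g j a)%E) => _ [n _ <-].
  rewrite -lee_fin fineK // /series /= -sumEFin.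
  by apply: nneseries_lim_ge => k _ _; exact: g0.
have := cvg_series_cvg_0 cs => s0.
apply/cvgr0Pnorm_lt => e e0; move/cvgr0Pnorm_lt : s0 => /(_ (e ^+ 2)).
rewrite exprn_gt0 // => /(_ isT); apply: filterS => j.
by rewrite normrX ltr_pXn2r ?nnegrE // ltW.
Unshelve. all: by end_near. Qed.

(** * The scales [N = J ^ 11] and [X = J ^ (22 d)], with [J = j + 1] *)

Lemma ln_natX (R : realType) (j m : nat) : ln (j.+1 ^ m)%:R = m%:R * ln j.+1%:R :> R.
Proof. by rewrite natrX lnXn // mulr_natl. Qed.

Lemma ln_nat_le (R : realType) (j : nat) : ln j.+1%:R <= j.+1%:R :> R.
Proof.
rewrite -natr1 addrC; apply: le_trans (le_ln1Dx _) _; last by rewrite lerDr.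
by apply: lt_le_trans (ltrN10 R) _.
Qed.

(** For an integer [1 <= n <= J ^ m], [n ^ (1 - x) <= J ^ (m (1 - x)) <= J]. This is where [x] has
    to be close to 1. *)
Lemma expR_ln_le (R : realType) (x : R) (j m k : nat) : x <= 1 -> (1 - x) * m%:R <= 1 ->
  (k < j.+1 ^ m)%N -> expR (- x * ln k.+1%:R) <= j.+1%:R * k.+1%:R^-1.
Proof.
move=> x1 xm kX; rewrite ler_pdivlMr // -[X in _ * X]lnK ?posrE // -expRD.
rewrite -[leRHS]lnK ?posrE // ler_expR (_ : _ + _ = (1 - x) * ln k.+1%:R); last ring.
have lk : ln k.+1%:R <= m%:R * ln j.+1%:R :> R.
  by rewrite -ln_natX ler_ln ?posrE ?ltr0n ?expn_gt0 // ler_nat.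
apply: le_trans (ler_wpM2l _ lk) _; first by rewrite subr_ge0.
by rewrite mulrA ler_piMl // ln_ge0 // ler1n.
Qed.

(** The logarithm is bounded crudely by [ln J <= J], which the exponent 11 can afford. *)
Lemma harmonic_sum_expn_le (R : realType) (j m : nat) :
  harmonic_sum R (j.+1 ^ m) <= (1 + m%:R) * j.+1%:R.
Proof.
have [n nE] : exists n, (j.+1 ^ m = n.+1)%N.
  by exists (j.+1 ^ m).-1; rewrite prednK // expn_gt0.
have := harmonic_sum_ln R n; rewrite -nE => /le_trans; apply.
rewrite ln_natX mulrDl mul1r; apply: lerD; first by rewrite ler1n.
by rewrite ler_wpM2l //; exact: ln_nat_le.
Qed.

(** Both sums over pairs are [O (J ^ 4)] and the harmonic sum of length [N] is [O (J)]. The bound is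
    therefore [O (J ^ 4 * J ^ 5 / N)], and [N = J ^ 11] makes it [O (J ^ -2)], summable over [j]. *)
Lemma integral_mean_off_diagonal_scale (R : realType) (t x M : R) (d j : nat) :
  (0 < d)%N -> x <= 1 -> (1 - x) * (22 * d)%:R <= 1 -> 0 <= M ->
  \int[lebesgue_measure]_(a in `[0, M])
     ((j.+1 ^ 11)%:R^-1 * \sum_(0 <= n < j.+1 ^ 11)
        off_diagonal (j.+1 ^ (22 * d)) x (t + a * n.+1%:R ^+ d)) ^+ 2
  <= (M * (1 + (22 * d)%:R) ^+ 4 + 16 * (1 + (22 * d)%:R) ^+ 5) * j.+1%:R ^- 2.
Proof.
move=> d0 x1 xd M0; have N0 : (0 < j.+1 ^ 11)%N by rewrite expn_gt0.
set m := (22 * d)%N in xd *; set K : R := 1 + m%:R; set J : R := j.+1%:R.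
have J1 : 1 <= J by rewrite ler1n.
have K0 : 0 <= K by rewrite addr_ge0.
have J0 : 0 <= J by lra.
apply: le_trans (integral_mean_off_diagonal_le t x _ d0 N0 M0) _.
set X := (j.+1 ^ m)%N; set N := (j.+1 ^ 11)%N in N0 *.
set S0 := \sum_(0 <= k < X) \sum_(0 <= l < X) cross_weight x k l.
set S1 := \sum_(0 <= k < X) \sum_(0 <= l < X) _.
have HX : harmonic_sum R X <= K * J by exact: harmonic_sum_expn_le.
have HN : harmonic_sum R N <= K * J.
  apply: le_trans HX; apply: harmonic_sum_le; apply: leq_pexp2l => //.
  by rewrite /m; lia.
have JH : (J * harmonic_sum R X) ^+ 2 <= K ^+ 2 * J ^+ 4.
  rewrite (_ : K ^+ 2 * J ^+ 4 = (J * (K * J)) ^+ 2); last ring.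
  rewrite ler_pXn2r ?nnegrE ?mulr_ge0 ?harmonic_sum_ge0 //.
  by rewrite ler_wpM2l.
have wk k : (k < X)%N -> expR (- x * ln k.+1%:R) <= J * k.+1%:R^-1 by exact: expR_ln_le.
have S0b : S0 <= K ^+ 2 * J ^+ 4.
  by apply: le_trans (sum_cross_weight_le wk) _; exact: JH.
have S1b : S1 <= 4 * (K ^+ 2 * J ^+ 4).
  by apply: le_trans (sum_cross_weight_inv_le wk) _; rewrite ler_wpM2l.
have S00 : 0 <= S0.
  by apply: sumr_ge0 => k _; apply: sumr_ge0 => l _; exact: cross_weight_ge0.
have S10 : 0 <= S1.
  apply: sumr_ge0 => k _; apply: sumr_ge0 => l _.
  by rewrite mulr_ge0 ?cross_weight_ge0 ?invr_ge0.
have H0 := harmonic_sum_ge0 R N.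
apply: (@le_trans _ _ (N%:R^-1 * (K ^+ 2 * J ^+ 4) *
   (M * (K ^+ 2 * J ^+ 4) + 4 * (K * J) * (4 * (K ^+ 2 * J ^+ 4))))).
  apply: ler_pM; rewrite ?addr_ge0 ?mulr_ge0 ?invr_ge0 //.
    by rewrite ler_wpM2l ?invr_ge0.
  apply: lerD; first by rewrite ler_wpM2l.
  by apply: ler_pM; rewrite ?mulr_ge0 // ler_wpM2l.
rewrite /N natrX -/J.
have -> : (M * K ^+ 4 + 16 * K ^+ 5) / J ^+ 2
   = J ^- 11 * (K ^+ 2 * J ^+ 4) * ((M * K ^+ 2 + 16 * K ^+ 3) * J ^+ 5).
  by field; rewrite gt_eqF //; lra.
rewrite ler_wpM2l ?mulr_ge0 ?invr_ge0 ?exprn_ge0 //.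
rewrite [leRHS]mulrDl; apply: lerD.
  by rewrite mulrA ler_wpM2l ?mulr_ge0 ?exprn_ge0 // [leRHS]exprS ler_peMl ?exprn_ge0.
by rewrite le_eqVlt; apply/orP; left; apply/eqP; ring.
Qed.

Definition mean_off_diagonal (R : realType) (x t : R) (d j : nat) (a : R) : R :=
  (j.+1 ^ 11)%:R^-1 * \sum_(0 <= n < j.+1 ^ 11)
    off_diagonal (j.+1 ^ (22 * d)) x (t + a * n.+1%:R ^+ d).

Lemma ae_mean_off_diagonal_cvg0 (R : realType) (x t : R) (d : nat) :
  (0 < d)%N -> x <= 1 -> (1 - x) * (22 * d)%:R <= 1 ->
  {ae (@lebesgue_measure R), forall a, 0 <= a ->
    (fun j => mean_off_diagonal x t d j a) @ \oo --> (0 : R)}.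
Proof.
move=> d0 x1 xd.
have cc (n k l : nat) : continuous
    (fun a : R => cos ((t + a * n.+1%:R ^+ d) * (ln k.+1%:R - ln l.+1%:R))).
  rewrite (_ : (fun a => _) = fun a => cos (t * (ln k.+1%:R - ln l.+1%:R)
     + n.+1%:R ^+ d * (ln k.+1%:R - ln l.+1%:R) * a)).
    exact: continuous_cos_affine.
  by apply/funext => y; congr cos; ring.
have cG j : continuous (mean_off_diagonal x t d j).
  move=> a; apply: cvgM; first exact: cvg_cst.
  apply: continuous_sum => n; apply: continuous_sum => k; apply: continuous_sum => l b.
  by apply: cvgM; [exact: cvg_cst|exact: cc].
(* The mean square bound concerns bounded intervals; integer values of [M] exhaust the half-line at
   the cost of countably many null sets. *)
have H (M : nat) := ae_cvg0_of_integral_sqr cG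
  (fun j => integral_mean_off_diagonal_scale t j d0 x1 xd (ler0n R M)).
apply: filterS (ae_foralln H) => a Ha a0.
apply: (Ha (Num.truncn a).+1); rewrite a0 /= ltW //.
exact: truncnS_gt.
Qed.

(** * Pointwise convergence of the means *)

Lemma nat_root_bracket (p N : nat) : (0 < p)%N -> (0 < N)%N ->
  exists r, (r.+1 ^ p <= N < r.+2 ^ p)%N.
Proof.
move=> p0 N0.
have ex : exists r, (r.+1 ^ p <= N)%N by exists 0%N; rewrite exp1n.
have ub r : (r.+1 ^ p <= N)%N -> (r <= N)%N.
  move=> h; apply: leq_trans h; apply: leq_trans (leqnSn r) _.
  by rewrite -{1}(expn1 r.+1) leq_pexp2l.
case: (ex_maxnP ex ub) => r rN rmax; exists r; rewrite rN /= ltnNge.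
by apply/negP => /rmax; rewrite ltnn.
Qed.

Lemma cvg_inv_nat (R : realType) : (fun j => j.+1%:R^-1 : R) @ \oo --> (0 : R).
Proof. exact: cvg_harmonic. Qed.

(** For [(r + 1) ^ p <= N < (r + 2) ^ p] monotonicity squeezes [A N / N] between the means at these
    two powers, up to a factor [((r + 2) / (r + 1)) ^ p] or its inverse, which tends to 1. *)
Lemma cvg_mean_interpolate (R : realType) (A : nat -> R) (p : nat) (L : R) : (0 < p)%N ->
  (forall n, 0 <= A n) -> {homo A : m n / (m <= n)%N >-> m <= n} ->
  (fun j => (j.+1 ^ p)%:R^-1 * A (j.+1 ^ p)%N) @ \oo --> L ->
  (fun N => N%:R^-1 * A N) @ \oo --> L.
Proof.
move=> p0 A0 mA bL.
have /choice[r rP] : forall N, exists r, (0 < N)%N -> (r.+1 ^ p <= N < r.+2 ^ p)%N.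
  move=> N; have [->|N0] := posnP N; first by exists 0%N.
  by have [r rN] := nat_root_bracket p0 N0; exists r.
pose b j : R := (j.+1 ^ p)%:R^-1 * A (j.+1 ^ p)%N.
have ry : r @ \oo --> \oo.
  apply/cvgnyPge => M; near=> N.
  have N0 : (0 < N)%N by near: N; exact: nbhs_infty_gt.
  have MN : (M.+1 ^ p <= N)%N by near: N; exact: nbhs_infty_ge.
  have /andP[_ h2] := rP _ N0.
  have : (M.+1 ^ p < (r N).+2 ^ p)%N by exact: leq_ltn_trans h2.
  by rewrite ltn_exp2r.
have q1 : (fun j => (j.+2%:R / j.+1%:R) ^+ p : R) @ \oo --> (1 : R).
  have h : (fun j => 1 + j.+1%:R^-1 : R) @ \oo --> (1 + 0 : R).
    by apply: cvgD; [exact: cvg_cst|exact: cvg_inv_nat].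
  rewrite addr0 in h.
  have := @cvg_comp _ _ _ _ _ _ _ _ h (@exprn_continuous R p 1); rewrite expr1n.
  rewrite (_ : _ \o _ = fun j => (j.+2%:R / j.+1%:R) ^+ p) //.
  by apply/funext => j /=; rewrite -[j.+2%:R]natr1 mulrDl divff // mul1r.
have up : (fun j => (j.+2%:R / j.+1%:R) ^+ p * b j.+1) @ \oo --> L.
  by rewrite -[L]mul1r; apply: cvgM => //; rewrite (cvg_shiftS b).
have qV : (fun j => ((j.+2%:R / j.+1%:R) ^+ p)^-1 : R) @ \oo --> (1^-1 : R).
  by apply: cvgV => //; exact: oner_neq0.
have lo : (fun j => ((j.+2%:R / j.+1%:R) ^+ p)^-1 * b j) @ \oo --> (1^-1 * L).
  exact: cvgM.
rewrite invr1 mul1r in lo.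
apply: (@squeeze_cvgr _ _ _ _ (fun N => ((fun j => ((j.+2%:R / j.+1%:R) ^+ p)^-1 * b j) \o r) N)
   (fun N => ((fun j => (j.+2%:R / j.+1%:R) ^+ p * b j.+1) \o r) N)); last 2 first.
- exact: cvg_comp ry lo.
- exact: cvg_comp ry up.
near=> N; have N0 : (0 < N)%N by near: N; exact: nbhs_infty_gt.
have /andP[r1 r2] := rP _ N0; rewrite /= /b.
set k := r N in r1 r2 *.
have NR : 0 < N%:R :> R by rewrite ltr0n.
have k1 : 0 < k.+1%:R ^+ p :> R by rewrite exprn_gt0.
have k2 : 0 < k.+2%:R ^+ p :> R by rewrite exprn_gt0.
rewrite !natrX expr_div_n; apply/andP; split.
  rewrite (_ : _ * _ = (k.+2%:R ^+ p)^-1 * A (k.+1 ^ p)%N); last first.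
    by field; rewrite !gt_eqF.
  apply: ler_pM; rewrite ?invr_ge0 ?(ltW k2) ?A0 ?mA // lef_pV2 ?posrE //.
  by rewrite -natrX ler_nat ltnW.
rewrite [leRHS](_ : _ = (k.+1%:R ^+ p)^-1 * A (k.+2 ^ p)%N); last first.
  by field; rewrite !gt_eqF.
apply: ler_pM; rewrite ?invr_ge0 ?(ltW NR) ?A0 //.
  by rewrite lef_pV2 ?posrE // -natrX ler_nat.
by apply: mA; exact: ltnW.
Unshelve. all: by end_near. Qed.

(** The difference of the two sides is [e |z - w / e| ^ 2]. With [e] tending to 0 the main constant
    tends to 1. *)
Lemma sqnormcD_le_weighted (R : realType) (e : R) (z w : R[i]) : 0 < e ->
  sqnormc (z + w) <= (1 + e) * sqnormc z + (1 + e^-1) * sqnormc w.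
Proof.
case: z w => [a b] [c d] e0; rewrite /sqnormc /= -subr_ge0.
rewrite (_ : _ - _ = e * ((a - c / e) ^+ 2 + (b - d / e) ^+ 2)); last first.
  by field; rewrite gt_eqF.
by rewrite mulr_ge0 ?(ltW e0) // addr_ge0 ?sqr_ge0.
Qed.

(** Once [n + 1 >= 2 |t| / a], the phase is at least [a (n + 1) / 2] in modulus. The finitely many
    earlier phases are nonzero, and their ratios are added into [B]. *)
Lemma inv_sqr_phase_le (R : realType) (a t : R) (d : nat) : 0 < a -> (0 < d)%N ->
  (forall n : nat, t + a * n.+1%:R ^+ d != 0) ->
  exists2 D : R, 0 <= D & forall n : nat, (t + a * n.+1%:R ^+ d) ^- 2 <= D * n.+1%:R ^- 2.
Proof.
move=> a0 d0 u0; pose u n := t + a * n.+1%:R ^+ d.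
pose n0 := Num.truncn (2 * `|t| / a).
pose B := 2 / a + \sum_(0 <= n < n0.+1) n.+1%:R / `|u n|.
have B0 : 0 <= B.
  by rewrite addr_ge0 ?divr_ge0 ?(ltW a0) //; apply: sumr_ge0 => n _; rewrite divr_ge0.
have key n : n.+1%:R / `|u n| <= B.
  have un0 : 0 < `|u n| by rewrite normr_gt0; exact: u0.
  have [nn0|nn0] := ltnP n n0.+1.
    rewrite /B (bigD1_seq n) ?mem_index_iota ?iota_uniq //=.
    rewrite addrCA lerDl addr_ge0 ?divr_ge0 ?(ltW a0) //.
    by apply: sumr_ge0 => m _; rewrite divr_ge0.
  apply: (@le_trans _ _ (2 / a)); last first.
    by rewrite lerDl; apply: sumr_ge0 => m _; rewrite divr_ge0.
  rewrite ler_pdivrMr // mulrAC ler_pdivlMr //.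
  have h1 : 2 * `|t| <= n.+1%:R * a.
    rewrite -ler_pdivrMr //; apply: le_trans (ltW (truncnS_gt _)) _.
    by rewrite ler_nat; apply: leq_trans nn0 _.
  have h2 : n.+1%:R <= n.+1%:R ^+ d :> R by rewrite ler_eXnr // ler1n.
  have h3 : a * n.+1%:R <= a * n.+1%:R ^+ d by rewrite ler_wpM2l // ltW.
  have h4 : a * n.+1%:R ^+ d <= `|u n| + `|t|.
    rewrite (_ : a * _ = u n - t); last by rewrite /u; ring.
    by apply: le_trans (ler_norm _) (ler_normB _ _).
  by lra.
exists (B ^+ 2); first exact: sqr_ge0.
move=> n; rewrite -/(u n) -(real_normK (num_real (u n))).
have un0 : 0 < `|u n| by rewrite normr_gt0; exact: u0.
rewrite ler_pdivlMr ?exprn_gt0 // mulrC -expr_div_n ler_pXn2r ?nnegrE ?divr_ge0 //.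
Qed.

(** The term with [s - 1] contributes [X ^ (2 (1 - x)) <= J ^ 2] times the mean of the inverse
    squared phases, thus [O (J ^ 2 / N)]. For the tail, [n ^ (2 d) <= N ^ (2 d) = X] gives
    [|s| ^ 2 = O (X)], while [X ^ (- 2 x) <= J ^ 2 / X ^ 2]: the total is [O (J ^ 2 / X)]. The
    exponent [22 d] is twice [11 d] for this reason. *)
Lemma zeta_mean_error (R : realType) (zeta : R[i] -> R[i]) (x t a : R) (d : nat) :
  is_riemann_zeta zeta -> (0 < d)%N -> 1 / 2 < x -> x <= 1 -> (1 - x) * (22 * d)%:R <= 1 ->
  0 < a -> (forall n : nat, t + a * n.+1%:R ^+ d != 0) ->
  exists C : R, forall j : nat,
    (j.+1 ^ 11)%:R^-1 * (\sum_(0 <= n < j.+1 ^ 11)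
      sqnormc (zeta (x +i* (t + a * n.+1%:R ^+ d))%C
       - \sum_(0 <= k < j.+1 ^ (22 * d)) npow_opp k.+1 (x +i* (t + a * n.+1%:R ^+ d))%C))
    <= C * j.+1%:R ^- 2.
Proof.
move=> zP d0 x2 x1 xd a0 u0; have x0 : 0 < x by lra.
have [D D0 uD] := inv_sqr_phase_le a0 d0 u0.
pose C1 := 1 + 2 * t ^+ 2 + 2 * a ^+ 2.
have C10 : 0 <= C1 by rewrite /C1; have := sqr_ge0 t; have := sqr_ge0 a; lra.
exists (4 * D + 16 * C1) => j.
set N := (j.+1 ^ 11)%N; set X := (j.+1 ^ (22 * d))%N; set J : R := j.+1%:R.
have J1 : 1 <= J by rewrite ler1n.
have J0 : 0 < J by lra.
have NJ : N%:R = J ^+ 11 :> R by rewrite natrX.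
have XJ : X%:R = J ^+ (22 * d) :> R by rewrite natrX.
have X0 : 0 < X%:R :> R by rewrite XJ exprn_gt0.
have X4 : J ^+ 4 <= X%:R by rewrite XJ ler_weXn2l //; lia.
have XE : X = X.-1.+1 by rewrite prednK // expn_gt0.
have eX : expR (- x * ln X%:R) <= J * X%:R^-1.
  by rewrite XE; apply: (expR_ln_le x1 xd); rewrite -/X {2}XE.
have eX1 : expR ((1 - x) * ln X%:R) <= J.
  rewrite (_ : _ * _ = - x * ln X%:R + ln X%:R); last ring.
  by rewrite expRD lnK ?posrE // -ler_pdivlMr.
have term n : (n < N)%N ->
   sqnormc (zeta (x +i* (t + a * n.+1%:R ^+ d))%C
       - \sum_(0 <= k < X) npow_opp k.+1 (x +i* (t + a * n.+1%:R ^+ d))%C)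
   <= 2 * J ^+ 2 * D * n.+1%:R ^- 2 + 16 * C1 * J ^- 2.
  move=> nN; set u := t + a * n.+1%:R ^+ d.
  have un0 : u != 0 by exact: u0.
  rewrite (zeta_eq_zeta_em X.-1 zP x0 un0) XE.
  apply: le_trans (zeta_em_error X.-1 x0 un0) _; rewrite -XE; apply: lerD.
    rewrite -mulrA (_ : 2 * J ^+ 2 * D * _ = 2 * (J ^+ 2 * (D * n.+1%:R ^- 2))); last by ring.
    apply: ler_wpM2l => //; apply: ler_pM; rewrite ?expR_ge0 ?invr_ge0 ?sqr_ge0 //.
    rewrite (_ : 2 * _ = (1 - x) * ln X%:R + (1 - x) * ln X%:R); last ring.
      by rewrite expRD expr2; apply: ler_pM; rewrite ?expR_ge0.
    exact: uD.
  rewrite (_ : - (2 * x) * ln X%:R = - x * ln X%:R + - x * ln X%:R); last ring.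
  rewrite expRD.
  have xx : (x ^+ 2)^-1 <= 4.
    rewrite -[leRHS]invrK lef_pV2 ?posrE ?exprn_gt0 ?invr_gt0 //.
    rewrite (_ : 4^-1 = (1 / 2) ^+ 2); last by field.
    by rewrite ler_pXn2r ?nnegrE //; lra.
  have u2 : x ^+ 2 + u ^+ 2 <= C1 * X%:R.
    have t2 : u ^+ 2 <= 2 * t ^+ 2 + 2 * (a * n.+1%:R ^+ d) ^+ 2.
      rewrite -subr_ge0 (_ : _ - _ = (t - a * n.+1%:R ^+ d) ^+ 2) ?sqr_ge0 //.
      by rewrite /u; ring.
    have nX : (n.+1%:R ^+ d) ^+ 2 <= X%:R :> R.
      rewrite (_ : X%:R = (N%:R ^+ d) ^+ 2 :> R); last first.
        by rewrite XJ NJ -exprM -exprM [(d * 2)%N]mulnC mulnA.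
      rewrite ler_pXn2r ?nnegrE ?exprn_ge0 // ler_pXn2r ?nnegrE //.
      by rewrite ler_nat.
    have xx1 : x ^+ 2 <= 1 by rewrite expr_le1 // ltW.
    have X1 : 1 <= X%:R :> R by rewrite XJ exprn_ege1.
    have t3 : 2 * (a * n.+1%:R ^+ d) ^+ 2 <= 2 * a ^+ 2 * X%:R.
      by rewrite exprMn mulrA ler_wpM2l // mulr_ge0 ?sqr_ge0.
    have t4 : 2 * t ^+ 2 * 1 <= 2 * t ^+ 2 * X%:R by rewrite ler_wpM2l // mulr_ge0 ?sqr_ge0.
    by rewrite /C1 !mulrDl; lra.
  have xu0 : 0 <= x ^+ 2 + u ^+ 2 by rewrite addr_ge0 ?sqr_ge0.
  apply: (@le_trans _ _ (4 * (C1 * X%:R) * ((J * X%:R^-1) * (J * X%:R^-1)) * 4)).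
    apply: ler_pM => //; rewrite ?mulr_ge0 ?expR_ge0 ?invr_ge0 ?sqr_ge0 //.
    apply: ler_pM => //; rewrite ?mulr_ge0 ?expR_ge0 //.
      by rewrite ler_wpM2l.
    by apply: ler_pM; rewrite ?expR_ge0.
  rewrite (_ : _ * 4 = 16 * C1 * (J ^+ 2 * X%:R^-1)); last by field; rewrite gt_eqF.
  rewrite ler_wpM2l ?mulr_ge0 // ler_pdivrMr // ler_pdivlMl ?exprn_gt0 //.
  by rewrite -exprD.
apply: (@le_trans _ _ (N%:R^-1 * \sum_(0 <= n < N)
    (2 * J ^+ 2 * D * n.+1%:R ^- 2 + 16 * C1 * J ^- 2))).
  rewrite ler_wpM2l ?invr_ge0 //; apply: ler_sum_nat => n /andP[_ nN]; exact: term.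
rewrite big_split /= -mulr_sumr big_const_nat iter_addr addr0 subn0 mulrDr [leRHS]mulrDl.
apply: lerD.
  apply: (@le_trans _ _ (N%:R^-1 * (2 * J ^+ 2 * D * 2))).
    rewrite ler_wpM2l ?invr_ge0 // ler_wpM2l ?sum_inv_sqr_le2 // !mulr_ge0 // ltW.
  rewrite (_ : _ * (_ * 2) = 4 * D * (J ^+ 2 / N%:R)); last ring.
  rewrite ler_wpM2l ?mulr_ge0 // NJ ler_pdivrMr ?exprn_gt0 // ler_pdivlMl ?exprn_gt0 //.
  by rewrite -exprD ler_weXn2l.
by rewrite -[X in _ * X <= _]mulr_natl mulKf   // NJ expf_neq0 // gt_eqF.
Qed.

(** Identifies the diagonal sums, and allows a real limit to be read as the complex number
    [zeta x]. *)
Lemma zeta_real_gt1 (R : realType) (zeta : R[i] -> R[i]) (x : R) :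
  is_riemann_zeta zeta -> 1 < x ->
  (fun X => \sum_(0 <= k < X) expR (- x * ln k.+1%:R)) @ \oo --> complex.Re (zeta x%:C%C)
  /\ zeta x%:C%C = (complex.Re (zeta x%:C%C))%:C%C.
Proof.
move=> [zS _ _] x1; have /cvg_complexP[] := zS x%:C%C x1.
have E k : npow_opp k.+1 x%:C%C = (expR (- x * ln k.+1%:R))%:C%C :> R[i].
  by rewrite /npow_opp -rmorphN -rmorphM cexp_real.
have sE n : series (fun k => npow_opp k.+1 x%:C%C : R[i]^o) n
    = (\sum_(0 <= k < n) expR (- x * ln k.+1%:R))%:C%C.
  by rewrite /series /= rmorph_sum; apply: eq_bigr => k _; exact: E.
rewrite (_ : (fun n => complex.Re _) = fun n => \sum_(0 <= k < n) expR (- x * ln k.+1%:R)); last first.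
  by apply/funext => n; rewrite sE.
rewrite (_ : (fun n => complex.Im _) = fun=> 0); last by apply/funext => n; rewrite sE.
move=> hR hI; split => //.
have := cvg_lim (@Rhausdorff R) hI; rewrite lim_cst // => Im0.
by apply/eqP; rewrite eq_complex /= -Im0 !eqxx.
Qed.

(** Along [N = J ^ 11] the mean of [|P| ^ 2] is a partial sum of the series of [zeta (2 x)] plus
    [mean_off_diagonal]. The small mean of [|zeta - P| ^ 2] transfers the limit to [|zeta| ^ 2], and
    [cvg_mean_interpolate] reaches all [N]. *)
Lemma mean_square_zeta (R : realType) (zeta : R[i] -> R[i]) (x t a : R) (d : nat) :
  is_riemann_zeta zeta -> (0 < d)%N -> 1 / 2 < x -> x <= 1 -> (1 - x) * (22 * d)%:R <= 1 ->
  0 < a -> (forall n : nat, t + a * n.+1%:R ^+ d != 0) ->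
  (fun j => mean_off_diagonal x t d j a) @ \oo --> (0 : R) ->
  (fun N => N%:R^-1 * \sum_(0 <= n < N) sqnormc (zeta (x +i* (t + a * n.+1%:R ^+ d))%C))
    @ \oo --> complex.Re (zeta (2 * x)%:C%C).
Proof.
move=> zP d0 x2 x1 xd a0 u0 G0.
pose z n := zeta (x +i* (t + a * n.+1%:R ^+ d))%C.
pose P j n := \sum_(0 <= k < j.+1 ^ (22 * d)) npow_opp k.+1 (x +i* (t + a * n.+1%:R ^+ d))%C.
pose Nj j := (j.+1 ^ 11)%N.
pose p (j : nat) : R := (Nj j)%:R^-1 * \sum_(0 <= n < Nj j) sqnormc (P j n).
pose q (j : nat) : R := (Nj j)%:R^-1 * \sum_(0 <= n < Nj j) sqnormc (z n).
pose e (j : nat) : R := (Nj j)%:R^-1 * \sum_(0 <= n < Nj j) sqnormc (z n - P j n).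
have [C eC] : exists C : R, forall j, e j <= C * j.+1%:R ^- 2.
  by have [C HC] := zeta_mean_error zP d0 x2 x1 xd a0 u0; exists C => j; exact: HC.
set L := complex.Re _.
have x21 : 1 < 2 * x by lra.
have [zL _] := zeta_real_gt1 zP x21.
have NjR j : 0 < (Nj j)%:R :> R by rewrite ltr0n expn_gt0.
have pE j : p j = \sum_(0 <= k < j.+1 ^ (22 * d)) expR (- (2 * x) * ln k.+1%:R)
     + mean_off_diagonal x t d j a.
  rewrite /p /P; under eq_bigr do rewrite sqnormc_dirichlet.
  rewrite big_split /= mulrDr; congr (_ + _).
  by rewrite big_const_nat iter_addr addr0 subn0 -[X in _ * X]mulr_natl mulKf // gt_eqF.
have powy : (fun j => j.+1 ^ (22 * d))%N @ \oo --> \oo.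
  apply/cvgnyPge => M; near=> j.
  have Mj : (M <= j.+1)%N by apply: leqW; near: j; exact: nbhs_infty_ge.
  by apply: leq_trans Mj _; rewrite -{1}(expn1 j.+1) leq_pexp2l // muln_gt0.
have pL : p @ \oo --> L.
  rewrite (_ : p = fun j => \sum_(0 <= k < j.+1 ^ (22 * d)) expR (- (2 * x) * ln k.+1%:R)
     + mean_off_diagonal x t d j a); last exact/funext.
  rewrite -[L]addr0; apply: cvgD; last exact: G0.
  exact: (@cvg_comp _ _ _ _ _ _ _ _ powy zL).
have cj := @cvg_inv_nat R.
(* The rate [J ^ -2] of the error beats the factor [1 + J] of the weighted inequality. *)
have ee0 : (fun j => (1 + j.+1%:R) * (C * j.+1%:R ^- 2)) @ \oo --> (0 : R).
  have h : (fun j => C * (j.+1%:R^-1 * j.+1%:R^-1) + C * j.+1%:R^-1 : R) @ \oo --> (C * (0 * 0) + C * 0 : R).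
    by apply: cvgD; apply: cvgM; try exact: cvg_cst; last exact: cj; apply: cvgM; exact: cj.
  rewrite !mulr0 addr0 in h; apply: cvg_trans h; apply: near_eq_cvg; near=> j.
  by field; rewrite nat1r pnatr_eq0.
(* Compare [|z|^2] with [|P|^2] and conversely, with weight [1 / (j + 1)] in the
   weighted triangle inequality. *)
have qb j : q j <= (1 + j.+1%:R^-1) * p j + (1 + j.+1%:R) * (C * j.+1%:R ^- 2).
  apply: (@le_trans _ _ ((1 + j.+1%:R^-1) * p j + (1 + j.+1%:R) * e j)); last first.
    by rewrite lerD2l ler_wpM2l ?addr_ge0.
  rewrite /q /p /e mulrCA [X in _ <= _ + X]mulrCA -mulrDr ler_wpM2l ?invr_ge0 //.
  rewrite !mulr_sumr -big_split /=; apply: ler_sum => n _.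
  have := @sqnormcD_le_weighted R j.+1%:R^-1 (P j n) (z n - P j n).
  by rewrite (_ : P j n + (z n - P j n) = z n) ?invrK; [apply; rewrite invr_gt0|ring].
have pb j : p j <= (1 + j.+1%:R^-1) * q j + (1 + j.+1%:R) * (C * j.+1%:R ^- 2).
  apply: (@le_trans _ _ ((1 + j.+1%:R^-1) * q j + (1 + j.+1%:R) * e j)); last first.
    by rewrite lerD2l ler_wpM2l ?addr_ge0.
  rewrite /q /p /e mulrCA [X in _ <= _ + X]mulrCA -mulrDr ler_wpM2l ?invr_ge0 //.
  rewrite !mulr_sumr -big_split /=; apply: ler_sum => n _.
  have := @sqnormcD_le_weighted R j.+1%:R^-1 (z n) (P j n - z n).
  rewrite (_ : z n + (P j n - z n) = P j n); last by ring.
  rewrite invrK (_ : sqnormc (P j n - z n) = sqnormc (z n - P j n)).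
    by apply; rewrite invr_gt0.
  by rewrite /sqnormc !raddfB /=; ring.
have c1 : (fun j => 1 + j.+1%:R^-1 : R) @ \oo --> (1 + 0 : R).
  by apply: cvgD; [exact: cvg_cst|exact: cj].
rewrite addr0 in c1.
have c1V : (fun j => (1 + j.+1%:R^-1)^-1 : R) @ \oo --> (1^-1 : R).
  by apply: cvgV => //; exact: oner_neq0.
rewrite invr1 in c1V.
have qL : q @ \oo --> L.
  apply: (@squeeze_cvgr _ _ _ _
    (fun j => (1 + j.+1%:R^-1)^-1 * (p j - (1 + j.+1%:R) * (C * j.+1%:R ^- 2)))
    (fun j => (1 + j.+1%:R^-1) * p j + (1 + j.+1%:R) * (C * j.+1%:R ^- 2))).
  - near=> j; rewrite qb andbT ler_pdivrMl; last by rewrite ltr_wpDr ?invr_ge0.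
    by rewrite lerBlDr; exact: pb.
  - have := cvgM c1V (cvgB pL ee0); rewrite subr0 mul1r; exact.
  - have := cvgD (cvgM c1 pL) ee0; rewrite mul1r addr0; exact.
apply: (@cvg_mean_interpolate R (fun N => \sum_(0 <= n < N) sqnormc (z n)) 11) => //.
- by move=> N; apply: sumr_ge0 => n _; exact: sqnormc_ge0.
- move=> m n mn; rewrite (big_cat_nat (leq0n m) mn) /= lerDl.
  by apply: sumr_ge0 => k _; exact: sqnormc_ge0.
Unshelve. all: by end_near. Qed.

(** Each [n] excludes a single [a]. Off this countable set no sampled point lies on the real axis,
    where the Euler-Maclaurin identity was not established. *)
Lemma ae_phase_neq0 (R : realType) (t : R) (d : nat) :
  {ae (@lebesgue_measure R), forall a : R, forall n : nat, t + a * n.+1%:R ^+ d != 0}.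
Proof.
apply: ae_foralln => n; exists [set - t / n.+1%:R ^+ d]; split => //.
  exact: lebesgue_measure_set1.
move=> a /= /negP; rewrite negbK => /eqP E.
have n0 : n.+1%:R ^+ d != 0 :> R by rewrite expf_neq0 // pnatr_eq0.
by apply: (mulIf n0); rewrite divfK //; lra.
Qed.

(** * Computability of the threshold *)

Lemma recursive_addn (n c : nat) (f : n.-tuple nat -> nat) :
  recursive f -> recursive (fun v => c + f v)%N.
Proof.
elim: c => [|c IH] rf //.
have -> : (fun v => c.+1 + f v)%N
    = (fun v => (fun w : 1.-tuple nat => (thead w).+1) [tuple (c + f v)%N | _ < 1]).
  by apply/funext => v; rewrite /thead tnth_mktuple addSn.
exact: (rec_comp rec_succ (fun _ => IH rf)).
Qed.

Lemma recursive_cst (n c : nat) : recursive (fun _ : n.-tuple nat => c).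
Proof.
rewrite (_ : (fun _ => c) = fun v : n.-tuple nat => (c + (fun _ : n.-tuple nat => 0) v)%N).
  apply: recursive_addn.
  (* The zero function of [n] arguments is the nullary one composed with the empty family. *)
  by apply: (@rec_comp 0 n _ (fun _ _ => 0%N) rec_zero) => -[].
by apply/funext => v; rewrite addn0.
Qed.

Lemma recursive_affine (a b : nat) : recursive (fun v : 2.-tuple nat => a * thead v + b)%N.
Proof.
(* Entry 1 of the tuple passed to the step function is the previous value, to which [a] is added. *)
apply: (@rec_prim 1 (fun=> b) (fun w => a + tnth w (inord 1))%N).
- exact: recursive_cst.
- exact: recursive_addn (rec_proj _).
- by move=> v; rewrite theadE muln0.
- by move=> k v; rewrite !theadE (tnth_nth 0%N) inordK //= mulnS addnA.
Qed.

(** The number [1 - 1 / (22 (d + 1))] in the shape [p / (p + 1)]: one recursive function gives both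
    numerator and denominator, and the approximation is exact for every precision. *)
Definition smo (R : realType) (d : nat) : R := (22 * d + 21)%:R / (22 * d + 21).+1%:R.

Lemma smoE (R : realType) (d : nat) : smo R d = 1 - 22^-1 * d.+1%:R^-1.
Proof.
rewrite /smo (_ : (22 * d + 21).+1 = (22 * d.+1)%N); last by lia.
rewrite (_ : (22 * d + 21)%:R = (22 * d.+1)%:R - 1 :> R); last first.
  by rewrite -(natrB _ (_ : 1 <= 22 * d.+1)%N) //; congr (_%:R); lia.
rewrite natrM mulrBl divff ?mulf_neq0 ?pnatr_eq0 // mul1r invfM //.
Qed.

Lemma computable_smo (R : realType) : computable_seq (smo R).
Proof.
exists (fun v => 22 * thead v + 21)%N, (fun=> 0%N), (fun v => 22 * thead v + 21)%N.
split; try exact: recursive_affine; first exact: recursive_cst.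
move=> d k; rewrite theadE subr0 /smo subrr normr0 invr_ge0.
exact: exprn_ge0.
Qed.

Theorem theorem2 (R : realType) (zeta : R[i] -> R[i])
    (zetaP : is_riemann_zeta zeta) :
  exists Smo : nat -> R,
    [/\ computable_seq Smo,
        forall d : nat, (2 <= d)%N -> 1 / 2 < Smo d < 1,
        Smo @ \oo --> (1 : R)
      & forall (d : nat) (sigma t : R), (2 <= d)%N -> Smo d < sigma <= 1 ->
          {ae (@lebesgue_measure R), forall a : R, 0 <= a ->
            (fun N : nat =>
               1 / N%:R * \sum_(1 <= n < N.+1)
                 `|zeta ((sigma +i* t)%C + 'i%C * (a * n%:R ^+ d)%:C%C)| ^+ 2
               : R[i]^o) @ \oo --> (zeta (2 * sigma)%:C%C : R[i]^o)}].
Proof.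
have smo12 (d : nat) : 1 / 2 < smo R d < 1.
  have d0 : 0 < d.+1%:R^-1 :> R by rewrite invr_gt0.
  have d1 : d.+1%:R^-1 <= 1 :> R by rewrite invf_le1 // ler1n.
  by rewrite smoE; move: d0 d1; set y := d.+1%:R^-1 => d0 d1; lra.
exists (smo R); split; [exact: computable_smo|by move=> d _; exact: smo12| |].
  have h := cvgB (@cvg_cst R 1 _ \oo _) (cvgM (@cvg_cst R 22^-1 _ \oo _) (@cvg_inv_nat R)).
  rewrite mulr0 subr0 in h; rewrite (_ : smo R = fun d => 1 - 22^-1 * d.+1%:R^-1); first exact: h.
  by apply/funext => d; rewrite smoE.
move=> d x t d2 /andP[xd x1]; have d0 : (0 < d)%N by exact: leq_trans d2.
have /andP[s12 _] := smo12 d; have x2 : 1 / 2 < x by lra.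
have xd1 : (1 - x) * (22 * d)%:R <= 1.
  have h : 1 - x <= 22^-1 * d.+1%:R^-1 by move: xd; rewrite smoE; set y := 22^-1 * _; lra.
  apply: (le_trans (ler_wpM2r (ler0n R _) h)).
  rewrite natrM mulrACA mulVf ?pnatr_eq0 // mul1r ler_pdivrMl // mulr1 ler_nat.
  exact: leqnSn.
have x21 : 1 < 2 * x by lra.
have [_ zE] := zeta_real_gt1 zetaP x21.
have A1 := ae_mean_off_diagonal_cvg0 t d0 x1 xd1.
have A2 := ae_phase_neq0 t d.
(* With zero shift and exponent 1, the case [n = 0] excludes [a = 0]. *)
have A3 := ae_phase_neq0 (0 : R) 1.
have FF := ae_filter_ringOfSetsType (@lebesgue_measure R).
apply: filterS3 A1 A2 A3 => a G0 u0 a_neq0 a_ge0.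
have a0 : 0 < a.
  by rewrite lt_neqAle a_ge0 andbT eq_sym; have := a_neq0 0%N; rewrite add0r expr1n mulr1.
have := mean_square_zeta zetaP d0 x2 x1 xd1 a0 u0 (G0 a_ge0).
move=> /cvg_real_complex; rewrite -zE; apply: cvg_trans; apply: near_eq_cvg; near=> N.
rewrite big_add1 /= rmorphM fmorphV rmorph_nat div1r rmorph_sum /=; congr (_ * _).
apply: eq_bigr => n _; rewrite /sqnormc add_Re2_Im2; congr (`|zeta _| ^+ 2).
by apply/eqP; rewrite eq_complex /=; apply/andP; split; apply/eqP; ring.
Unshelve. all: by end_near. Qed.
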